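(* Let $\mathcal{E}$ be a $p$-dimensional invariant subspace of $A$ and let $\mathcal{S}=\{X\in\mathbb{R}^{n\times p}:\mathrm{col}(X)=\mathcal{E},\ X^TX=I_p\}$. Then there is an open set $U\subseteq\mathbb{R}_*^{n\times p}$ containing $\mathcal{S}$ such that, for every $X_0\in U$, the geometric Newton iteration for Oja's vector field started at $X_0$ generates a well-defined infinite sequence $(X_k)_{k\ge 0}$ in $\mathbb{R}_*^{n\times p}$, and the sequence of equivalence classes $(X_k\mathrm{O}_p)_{k\ge0}$ converges quadratically, in the quotient manifold $\mathbb{R}_*^{n\times p}/\mathrm{O}_p$, to the point $\mathcal{S}$ (which is a single equivalence class $V\mathrm{O}_p$, $V\in\mathcal{S}$).
   Context: Standing assumptions: $n,p$ are positive integers with $p<n$, and $A$ is a real symmetric positive-definite $n\times n$ matrix whose eigenvalues are all simple, $\lambda_1>\cdots>\lambda_n$. Notation: $\mathbb{R}_*^{n\times p}=\{X\in\mathbb{R}^{n\times p}:\det(X^TX)\neq 0\}$; $\mathrm{col}(X)$ is the column space of $X$; $\mathrm{O}_p=\{Q\in\mathbb{R}^{p\times p}:Q^TQ=I\}$; for a square matrix $B$, $\mathrm{skew}(B)=\tfrac12(B-B^T)$. The set $\mathbb{R}_*^{n\times p}/\mathrm{O}_p$ of equivalence classes $X\mathrm{O}_p=\{XQ:Q\in\mathrm{O}_p\}$ carries the unique smooth manifold structure for which $X\mapsto X\mathrm{O}_p$ is a submersion (the action $X\mapsto XQ$ is free and proper). For $X\in\mathbb{R}_*^{n\times p}$, $P^{\mathrm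 h}_X:\mathbb{R}^{n\times p}\to\mathbb{R}^{n\times p}$ is the linear map $P^{\mathrm h}_X(Z)=Z-X\,\mathrm{skew}\big((X^TX)^{-1}X^TZ\big)$, with image $\mathcal{H}_X=\{XS+X_\perp K: S\in\mathbb{R}^{p\times p},\,S^T=S,\ K\in\mathbb{R}^{(n-p)\times p}\}$, where $X_\perp\in\mathbb{R}^{n\times(n-p)}$ is any matrix with orthonormal columns satisfying $X^TX_\perp=0$. Geometric Newton iteration for Oja's vector field: given $X=X_k\in\mathbb{R}_*^{n\times p}$, solve the linear system $$P^{\mathrm h}_X\Big(AZ-ZX^TAX-XZ^TAX-XX^TAZ-Z\,\mathrm{skew}\big((X^TX)^{-1}X^TAX\big)-X\,\mathrm{skew}\big(-(X^TX)^{-1}(X^TZ+Z^TX)(X^TX)^{-1}X^TAX+(X^TX)^{-1}(Z^TAX+X^TAZ)\big)\Big)=-\Big(AX-XX^TAX-X\,\mathrm{skew}\big((X^TX)^{-1}X^TAX\big)\Big)$$ for the unknown $Z\in\mathcal{H}_X$, and set $X_{k+1}=X_k+Z$. The iteration is well defined at $X_k$ if this system has a unique solution $Z\in\mathcal{H}_{X_k}$ and $X_{k+1}\in\mathbb{R}_*^{n\times p}$. (This is Newton's method applied to the vector field on $\mathbb{R}_*^{n\times p}/\mathrm{O}_p$ with horizontal lift $X\mapsto P^{\mathrm h}_X(F(X))$, $F(X)=AX-XX^TAX$.) Quadratic convergence: a sequence $(x_k)$ in a smooth manifold $\mathcal{M}$ converges quadratically to $x_*$ if $x_k\to x_*$ and,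 for a chart $\varphi$ of $\mathcal{M}$ around $x_*$, there are constants $c\ge 0$ and $k_0$ such that $\|\varphi(x_{k+1})-\varphi(x_* )\|\le c\,\|\varphi(x_k)-\varphi(x_* )\|^2$ for all $k\ge k_0$ (this does not depend on the choice of chart). *)

(* Defs.v *)
From HB Require Import structures.
From mathcomp Require Import all_boot all_order all_algebra generic_quotient.
From mathcomp Require Import all_classical all_reals all_analysis.
Set Implicit Arguments.
Unset Strict Implicit.
Unset Printing Implicit Defensive.
Import Order.TTheory GRing.Theory Num.Theory.
Import numFieldNormedType.Exports.
Local Open Scope classical_set_scope.
Local Open Scope ring_scope.
Local Open Scope quotient_scope.

(** ** Smooth maps *)

Section Smooth.
Context {R : realType}.

(* For V finite-dimensional and D open this is the usual C^k: 'd f x is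
   continuous in x as soon as every x |-> 'd f x v is. *)
Fixpoint Ck_on {V W : normedModType R} (k : nat) (D : set V) (f : V -> W)
    : Prop :=
  if k is k'.+1 then
    (forall x, D x -> differentiable f x) /\
    (forall v, Ck_on k' D (fun x => 'd f x v))
  else forall x, D x -> {for x, continuous f}.

Definition smooth_on {V W : normedModType R} (D : set V) (f : V -> W) : Prop :=
  forall k, Ck_on k D f.

Definition submersion_on {V W : normedModType R} (D : set V) (f : V -> W)
    : Prop :=
  smooth_on D f /\ forall x, D x -> forall w, exists v, 'd f x v = w.

(* [chart D phi] says that phi, restricted to D, is a chart of M with
   domain D; outside D the values of phi are irrelevant. *)
Definition converges_quadratically {M : topologicalType} {d : nat}
    (chart : set M -> (M -> 'rV[R]_d) -> Prop) (x : nat -> M) (xs : M)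
    : Prop :=
  x k @[k --> \oo] --> xs /\
  exists (D : set M) (phi : M -> 'rV[R]_d),
    [/\ chart D phi, D xs &
      exists (c : R) (k0 : nat), 0 <= c /\
        forall k, (k0 <= k)%N ->
          D (x k) /\
          `|phi (x k.+1) - phi xs| <= c * `|phi (x k) - phi xs| ^+ 2].

End Smooth.

(** ** The quotient of the full-rank matrices by the orthogonal group *)

Section Quotient.
Variables (R : realType) (n p : nat).

Definition fullrank : set 'M[R]_(n, p) := [set X | \det (X^T *m X) != 0].

(* The subtype topology is the one induced by 'M[R]_(n, p). *)
Definition Mstar : topologicalType := set_type fullrank.

Definition orbit_rel (X Y : Mstar) : bool :=
  `[< exists2 Q : 'M[R]_p, Q^T *m Q = 1%:M & \val Y = \val X *m Q >].

Lemma orbit_rel_refl : reflexive orbit_rel.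
Proof.
by move=> X; apply/asboolP; exists 1%:M; rewrite ?mulmx1// trmx1.
Qed.

Lemma orbit_rel_sym : symmetric orbit_rel.
Proof.
suff H X Y : orbit_rel X Y -> orbit_rel Y X.
  by move=> X Y; apply/idP/idP; exact: H.
move=> /asboolP[Q QQ YX]; have QQ' := mulmx1C QQ.
apply/asboolP; exists Q^T; first by rewrite trmxK.
by rewrite YX -mulmxA QQ' mulmx1.
Qed.

Lemma orbit_rel_trans : transitive orbit_rel.
Proof.
move=> Y X Z /asboolP[Q QQ YX] /asboolP[P PP ZY]; apply/asboolP.
exists (Q *m P); last by rewrite ZY YX mulmxA.
by rewrite trmx_mul mulmxA -(mulmxA _ Q^T) QQ mulmx1.
Qed.

Definition orbit_equiv : equiv_rel Mstar :=
  EquivRel orbit_rel orbit_rel_refl orbit_rel_sym orbit_rel_trans.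

Definition quotO : topologicalType := quotient_topology {eq_quot orbit_equiv}.

Definition classO (X : Mstar) : quotO := \pi_quotO X.

Definition dim_quotO : nat := n * p - 'C(p, 2).

(* phi \o classO, extended by 0 from Mstar to all matrices so that its
   differential makes sense. *)
Definition class_lift (phi : quotO -> 'rV[R]_dim_quotO) (X : 'M[R]_(n, p))
    : 'rV[R]_dim_quotO :=
  if insub X is Some Y then phi (classO Y) else 0.

(* The charts of the unique smooth structure on quotO that makes classO a
   submersion: the bijections phi of an open set D onto an open subset of
   R^dim_quotO such that phi \o classO is a smooth submersion.  (Submersions
   have smooth local sections, so phi is a diffeomorphism onto its image for
   that structure exactly when phi \o classO is a submersion.) *)
Definition quot_chart (D : set quotO) (phi : quotO -> 'rV[R]_dim_quotO)
    : Prop :=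
  [/\ open D, {in D &, injective phi}, open (phi @` D) &
      submersion_on [set \val X | X in classO @^-1` D] (class_lift phi)].

Lemma classO_eqP (X Y : Mstar) :
  classO X = classO Y <->
  exists2 Q : 'M[R]_p, Q^T *m Q = 1%:M & \val Y = \val X *m Q.
Proof.
split=> [|XY].
  by move/(@eqquotP _ _ {eq_quot orbit_equiv} X Y)/asboolP.
by apply/(@eqquotP _ _ {eq_quot orbit_equiv} X Y)/asboolP.
Qed.

End Quotient.

Arguments fullrank R n p _ : clear implicits.

(** ** The Newton iteration *)

Section Newton.
Variables (R : realType) (n p : nat).
Implicit Types (A : 'M[R]_n) (X Z : 'M[R]_(n, p)).

Definition skew (B : 'M[R]_p) : 'M[R]_p := 2^-1 *: (B - B^T).

Definition proj_h X Z : 'M[R]_(n, p) :=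
  Z - X *m skew (invmx (X^T *m X) *m X^T *m Z).

Definition horizontal X : set 'M[R]_(n, p) :=
  [set Z | exists (Xp : 'M[R]_(n, n - p)) (S : 'M[R]_p) (K : 'M[R]_(n - p, p)),
    [/\ Xp^T *m Xp = 1%:M, X^T *m Xp = 0, S^T = S & Z = X *m S + Xp *m K]].

Definition newton_solution A X Z : Prop :=
  let G := invmx (X^T *m X) in
  horizontal X Z /\
  proj_h X
    (A *m Z - Z *m X^T *m A *m X - X *m Z^T *m A *m X - X *m X^T *m A *m Z
     - Z *m skew (G *m X^T *m A *m X)
     - X *m skew (- (G *m (X^T *m Z + Z^T *m X) *m G *m X^T *m A *m X)
                  + G *m (Z^T *m A *m X + X^T *m A *m Z)))
  = - (A *m X - X *m X^T *m A *m X - X *m skew (G *m X^T *m A *m X)).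

(* The step from X is well defined and leads to Y; the full rank of X + Z is
   carried by the type of Y. *)
Definition newton_step A (X Y : Mstar R n p) : Prop :=
  exists2 Z, unique (newton_solution A (\val X)) Z & \val Y = \val X + Z.

Definition orthonormal_bases (E : {vspace 'cV[R]_n}) : set 'M[R]_(n, p) :=
  [set X | <<[seq col j X | j : 'I_p]>>%VS = E /\ X^T *m X = 1%:M].

End Newton.

Arguments orthonormal_bases {R n} p E _.

(* Main.v *)
From Pilot Require Import Defs.
From HB Require Import structures.
From mathcomp Require Import all_boot all_order all_algebra generic_quotient.
From mathcomp Require Import all_classical all_reals all_analysis.
From mathcomp Require Import zify ring lra separable.
Set Implicit Arguments.
Unset Strict Implicit.
Unset Printing Implicit Defensive.
Import Order.TTheory GRing.Theory Num.Theory.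
Import numFieldNormedType.Exports.
Local Open Scope classical_set_scope.
Local Open Scope ring_scope.

(** Let V be an orthonormal basis of E, M = V^T A V, and let G(X) denote the
    horizontal lift of Oja's vector field, [oja_lift A X], which vanishes on V O_p.  The theorem
    rests on two facts about a neighbourhood of V O_p.

    The linearization of the Newton system at V is invertible.  On the
    directions V S with S symmetric it acts as S |-> - (S M + M S), which is
    injective because M is positive definite ([lyapunov_eq0]); on the directions Z
    with V^T Z = 0 it is Z |-> A Z - Z M, which is injective
    because the spectra of A on E and on its orthogonal complement are disjoint,
    all the eigenvalues being simple ([invariant_normal_eq0]).  Since the
    horizontal space moves with X, the system is replaced by an equivalent square
    one on all matrices, [newton_op], which is within O(|X - V|) of its value at
    V and hence uniformly invertible near V.  If moreover V^T X is symmetric, then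
    Delta = X - V is horizontal at V, the operator sends Delta to
    G(X) + O(|Delta|^2), and therefore the Newton step Z satisfies
    Z = - Delta + O(|Delta|^2).  This is [newton_local].

    Everything is equivariant under O_p, and the class of X is seen through the
    first block column of X X^T in an orthonormal frame [V C] adapted to E
    ([orbit_inv]).  When this quantity is close to its value at V, a square root
    of V^T X X^T V close to the identity yields a representative X Q of the class
    with V^T X Q symmetric and at comparable distance from V
    ([symmetric_representative]), so the local estimate becomes a quadratic
    contraction of the distance between classes ([newton_contracts]).  The
    entries of [orbit_inv] on and below the diagonal are n p - C(p, 2) polynomial
    functions of X which form a chart of the quotient around V O_p
    ([quot_chart_invariant]); in the max norm of this chart the distance to V O_p
    is exactly the quantity that is contracted. *)

(* The skew part of a square matrix, not the property of bilinear forms. *)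
Local Notation skew := Defs.skew.

(** * Norms of matrices *)

Section MatrixNorm.
Context {R : realType}.

Lemma mx_norm_leP m n (A : 'M[R]_(m, n)) (c : R) : 0 <= c ->
  (forall i j, `|A i j| <= c) -> `|A| <= c.
Proof.
move=> c0 Ac; rewrite [`|A|]mx_normrE; apply: bigmax_le => // ij _; exact: Ac.
Qed.

Lemma mx_entry_norm_le m n (A : 'M[R]_(m, n)) i j : `|A i j| <= `|A|.
Proof.
by rewrite [`|A|]mx_normrE; apply: (le_bigmax _ (fun ij => `|A ij.1 ij.2|) (i, j)).
Qed.

Lemma mulmx_norm_le m k n (A : 'M[R]_(m, k)) (B : 'M[R]_(k, n)) :
  `|A *m B| <= k%:R * `|A| * `|B|.
Proof.
apply: mx_norm_leP => [|i j]; first by rewrite !mulr_ge0.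
rewrite mxE (le_trans (ler_norm_sum _ _ _))//.
have -> : k%:R * `|A| * `|B| = \sum_(l < k) `|A| * `|B|.
  by rewrite sumr_const card_ord mulr_natl mulrnAl.
by apply: ler_sum => l _; rewrite normrM ler_pM// mx_entry_norm_le.
Qed.

Lemma trmx_norm m n (A : 'M[R]_(m, n)) : `|A^T| = `|A|.
Proof.
have le_tr k l (B : 'M[R]_(k, l)) : `|B^T| <= `|B|.
  by apply: mx_norm_leP => // i j; rewrite mxE mx_entry_norm_le.
by apply/le_anti; rewrite le_tr -[X in `|X| <= _]trmxK le_tr.
Qed.

Lemma orthonormal_norm_le1 m n (Q : 'M[R]_(m, n)) : Q^T *m Q = 1%:M -> `|Q| <= 1.
Proof.
move=> QQ; apply: mx_norm_leP => // i j.
have /(congr1 (fun M : 'M[R]_n => M j j)) := QQ.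
rewrite !mxE eqxx (bigD1 i)//= !mxE => Qij.
rewrite -(@ler_pXn2r _ 2)// ?nnegrE// expr1n -normrX ger0_norm ?sqr_ge0//.
rewrite -[leRHS]Qij expr2 lerDl sumr_ge0// => k _.
by rewrite mxE -expr2 sqr_ge0.
Qed.

Lemma mul_orthonormal_norm_le m n k (Q : 'M[R]_(n, k)) (A : 'M[R]_(m, n)) :
  Q^T *m Q = 1%:M -> `|A *m Q| <= n%:R * `|A|.
Proof.
move=> /orthonormal_norm_le1 Q1; rewrite (le_trans (mulmx_norm_le _ _))//.
by rewrite ler_piMr// mulr_ge0.
Qed.

(** Linear maps out of a matrix space are bounded, because there are finitely
    many elementary matrices. *)
Lemma linear_mx_bounded m n (W : normedModType R) (f : {linear 'M[R]_(m, n) -> W}) :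
  exists2 C, 0 <= C & forall A, `|f A| <= C * `|A|.
Proof.
exists (\sum_i \sum_j `|f (delta_mx i j)|); first by do 2!apply: sumr_ge0 => ? _.
move=> A; rewrite [in f A](matrix_sum_delta A) linear_sum mulr_suml.
rewrite (le_trans (ler_norm_sum _ _ _))//; apply: ler_sum => i _.
rewrite linear_sum mulr_suml (le_trans (ler_norm_sum _ _ _))//.
apply: ler_sum => j _.
by rewrite linearZ/= normrZ mulrC ler_wpM2l// mx_entry_norm_le.
Qed.

Lemma linear_mx_continuous m n (W : normedModType R)
  (f : {linear 'M[R]_(m, n) -> W}) : continuous f.
Proof.
have [C C0 fC] := linear_mx_bounded f.
apply: bounded_linear_continuous; exists C; split; first exact: ger0_real.
move=> x Cx; near=> A.
rewrite /= (le_trans (fC A))// (le_trans _ (ltW Cx))// ler_piMr//.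
Unshelve. all: by end_near.
Qed.

(** The matrix of f in the elementary basis is invertible, and its inverse is
    again a bounded linear map. *)
Lemma injective_linear_mx m n (f : {linear 'M[R]_(m, n) -> 'M[R]_(m, n)}) :
  (forall Z, f Z = 0 -> Z = 0) ->
  (forall B, exists Z, f Z = B) /\ exists2 C, 0 <= C & forall Z, `|Z| <= C * `|f Z|.
Proof.
move=> f_inj; have Fu : lin_mx f \in unitmx.
  rewrite -row_free_unit -kermx_eq0; apply/rowV0P => v /sub_kermxP vF.
  have fv : f (vec_mx v) = 0.
    by apply: (can_inj mxvecK); rewrite -mul_vec_lin vec_mxK vF linear0.
  by rewrite -[v]vec_mxK (f_inj _ fv) linear0.
pose g B := vec_mx (mxvec B *m invmx (lin_mx f)) : 'M[R]_(m, n).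
have fg Z : g (f Z) = Z by rewrite /g -mul_vec_lin mulmxK// mxvecK.
have gf B : f (g B) = B.
  by apply: (can_inj mxvecK); rewrite -mul_vec_lin /g vec_mxK mulmxKV.
split; first by move=> B; exists (g B).
have g_lin : linear g by move=> a B1 B2; rewrite /g linearP mulmxDl -scalemxAl linearP.
pose gL : {linear _ -> _} := HB.pack g (GRing.isLinear.Build _ _ _ _ _ g_lin).
have [C C0 gC] := linear_mx_bounded gL.
by exists C => // Z; rewrite -[X in `|X| <= _](fg Z); exact: gC.
Qed.

End MatrixNorm.

(** * Gram matrices and orthonormal frames *)

Section GramMatrices.
Context {R : realType}.

Lemma gram_eq0 m n (X : 'M[R]_(m, n)) : X^T *m X = 0 -> X = 0.
Proof.
move=> XX; apply/matrixP => i j.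
have /(congr1 (fun M : 'M[R]_n => M j j)) := XX; rewrite !mxE => /eqP.
rewrite psumr_eq0 => [|k _]; last by rewrite mxE -expr2 sqr_ge0.
move=> /allP/(_ i (mem_index_enum _)); rewrite mxE -expr2 sqrf_eq0.
by move=> /eqP.
Qed.

Lemma gram_unit m n (X : 'M[R]_(m, n)) (Y : 'M[R]_(n, m)) :
  Y *m X = 1%:M -> X^T *m X \in unitmx.
Proof.
move=> YX; rewrite -row_free_unit -kermx_eq0; apply/rowV0P => v /sub_kermxP vXX.
suff Xv : X *m v^T = 0.
  by apply: trmx_inj; rewrite -[v^T]mul1mx -YX -mulmxA Xv mulmx0 trmx0.
by apply: gram_eq0; rewrite trmx_mul trmxK mulmxA -(mulmxA v) vXX mul0mx.
Qed.

Lemma fullrankE m n (X : 'M[R]_(m, n)) : fullrank R m n X <-> X^T *m X \in unitmx.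
Proof. by rewrite /fullrank/= unitmxE unitfE. Qed.

Lemma exists_unit_normal m n (X : 'M[R]_(n, m)) : (m < n)%N ->
  exists2 u : 'cV[R]_n, u^T *m u = 1%:M & X^T *m u = 0.
Proof.
move=> mn; have : kermx X != 0.
  by rewrite kermx_eq0 /row_free neq_ltn (leq_ltn_trans (rank_leq_col X) mn).
rewrite -nz_row_eq0; set v := nz_row _ => v0.
have vX : v *m X = 0 by apply/sub_kermxP; exact: nz_row_sub.
have vv : 0 < (v *m v^T) 0 0.
  rewrite lt_def; apply/andP; split.
    apply: contraNneq v0 => vv; apply/eqP/trmx_inj; rewrite trmx0; apply: gram_eq0.
    by rewrite trmxK; apply/matrixP => i j; rewrite !ord1 vv mxE.
  by rewrite mxE sumr_ge0// => i _; rewrite mxE -expr2 sqr_ge0.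
pose a := (Num.sqrt ((v *m v^T) 0 0))^-1; exists (a *: v^T).
  have -> : (a *: v^T)^T = a *: v by apply/matrixP => i j; rewrite !mxE.
  rewrite -scalemxAl -scalemxAr scalerA -expr2 exprVn sqr_sqrtr ?ltW//.
  by apply/matrixP => i j; rewrite !ord1 [LHS]mxE mulVf ?gt_eqF// mxE.
have Xv : X^T *m v^T = 0 by rewrite -trmx_mul vX trmx0.
by rewrite -scalemxAr Xv scaler0.
Qed.

Lemma exists_orthonormal_normal k m n (X : 'M[R]_(n, m)) : (m + k <= n)%N ->
  exists2 C : 'M[R]_(n, k), C^T *m C = 1%:M & X^T *m C = 0.
Proof.
elim: k m X => [|k IHk] m X mkn.
  by exists 0; [rewrite [LHS]flatmx0 [RHS]flatmx0 | rewrite mulmx0].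
have [|u uu Xu] := exists_unit_normal X; first by lia.
have [|C CC] := IHk _ (row_mx X u); first by lia.
rewrite tr_row_mx mul_col_mx -[RHS]col_mx0 => /eq_col_mx[XC uC].
suff: exists2 D : 'M[R]_(n, 1 + k), D^T *m D = 1%:M & X^T *m D = 0 by [].
exists (row_mx u C); last by rewrite mul_mx_row Xu XC row_mx0.
have Cu : C^T *m u = 0 by apply: trmx_inj; rewrite trmx_mul trmxK uC trmx0.
by rewrite tr_row_mx mul_col_row uu CC uC Cu -scalar_mx_block.
Qed.

Lemma in_span_cols n p (X : 'M[R]_(n, p)) (v : 'cV[R]_n) :
  v \in <<[seq col j X | j : 'I_p]>>%VS <-> exists c, v = X *m c.
Proof.
have mulX c : X *m c = \sum_j c j 0 *: col j X.
  apply/colP => i; rewrite summxE mxE; apply: eq_bigr => j _.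
  by rewrite !mxE mulrC.
split=> [|[c ->]].
  rewrite span_def big_image/= => /memv_sumP[u uX ->].
  have {}uX j : exists a, u j = a *: col j X.
    by apply/vlineP; exact: uX.
  have [a ua] := choice uX.
  exists (\col_j a j); rewrite mulX; apply: eq_bigr => j _.
  by rewrite mxE ua.
rewrite mulX; apply: memv_suml => j _; apply: memvZ; apply: memv_span.
by apply/mapP; exists j; rewrite ?mem_enum.
Qed.

(** Taking the orthonormal complement twice turns an arbitrary basis of E into
    an orthonormal one, together with the complementary frame. *)
Lemma exists_orthonormal_basis p q (E : {vspace 'cV[R]_(p + q)}) : \dim E = p ->
  exists (V : 'M[R]_(p + q, p)) (C : 'M[R]_(p + q, q)),
    [/\ orthonormal_bases p E V, C^T *m C = 1%:M & V^T *m C = 0].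
Proof.
move=> Ep; pose B : 'M[R]_(p + q, p) := \matrix_(i, j) (vbasis E)`_j i 0.
have [|C CC BC] := @exists_orthonormal_normal q p _ B => //.
have [|V VV CV] := @exists_orthonormal_normal p q _ C; first by rewrite addnC.
have VC : V^T *m C = 0 by apply: trmx_inj; rewrite trmx_mul trmxK CV trmx0.
exists V, C; split => //; split => //.
pose W : 'M[R]_(p + q) := row_mx V C.
have WW : W *m W^T = 1%:M.
  by apply: mulmx1C; rewrite tr_row_mx mul_col_row VV CC CV VC -scalar_mx_block.
have BV : B = V *m (V^T *m B).
  rewrite -[LHS]mul1mx -WW tr_row_mx mul_row_col mulmxDl -!mulmxA.
  have -> : C^T *m B = 0 by apply: trmx_inj; rewrite trmx_mul trmxK BC trmx0.
  by rewrite mulmx0 addr0.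
apply/esym/eqP; rewrite eqEdim; apply/andP; split; last first.
  by rewrite Ep (leq_trans (dim_span _))// size_image card_ord.
apply/subvP => x /coord_vbasis ->; apply: memv_suml => i _; apply: memvZ.
apply/in_span_cols; have ip : (i < p)%N by rewrite -{2}Ep.
exists (V^T *m B *m delta_mx (Ordinal ip) 0); rewrite mulmxA -BV.
by apply/colP => k; rewrite -colE !mxE.
Qed.

End GramMatrices.

(** * Sylvester and Lyapunov equations *)

Section Spectrum.
Context {R : realType}.

Lemma char_poly_orthogonal_conj n (A W : 'M[R]_n) : W^T *m W = 1%:M ->
  char_poly (W^T *m A *m W) = char_poly A.
Proof.
move=> WW; pose U := map_mx (@polyC R) W; pose U' := map_mx (@polyC R) W^T.
have UU : U' *m U = 1%:M by rewrite -map_mxM WW map_mx1.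
have -> : char_poly (W^T *m A *m W) = \det (U' *m char_poly_mx A *m U).
  rewrite /char_poly /char_poly_mx mulmxBr mulmxBl !map_mxM.
  by rewrite scalar_mxC -(mulmxA _ U') UU mulmx1.
by rewrite !det_mulmx mulrAC -det_mulmx UU det1 mul1r.
Qed.

Lemma char_poly_block_diag p q (M : 'M[R]_p) (N : 'M[R]_q) :
  char_poly (block_mx M 0 0 N) = char_poly M * char_poly N.
Proof.
rewrite /char_poly -(det_ublock _ 0); congr (\det _).
by rewrite /char_poly_mx map_block_mx !map_mx0 scalar_mx_block opp_block_mx
  add_block_mx !oppr0 !addr0.
Qed.

(** If u, v satisfy Bezout's identity for the two characteristic polynomials,
    then by Cayley-Hamilton K = u(N) char_poly N (N) K + v(N) K char_poly M (M)
    is zero. *)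
Lemma sylvester_eq0 p q (M : 'M[R]_p) (N : 'M[R]_q) (K : 'M[R]_(q, p)) :
  coprimep (char_poly N) (char_poly M) -> N *m K = K *m M -> K = 0.
Proof.
case: p M K => [|p] M K; first by rewrite [K]thinmx0.
case: q N K => [|q] N K; first by rewrite [K]flatmx0.
move=> /Bezout_eq1_coprimepP[[u v]/= uv] NK.
have hK r : horner_mx N r *m K = K *m horner_mx M r.
  elim/poly_ind: r => [|r c IH]; first by rewrite !rmorph0 mul0mx mulmx0.
  rewrite !rmorphD !rmorphM/= !horner_mx_C !horner_mx_X mulmxDl mulmxDr.
  rewrite -scalar_mxC; congr (_ + _).
  by rewrite -!mulmxE -mulmxA NK !mulmxA IH.
rewrite -[K]mul1mx -[1%:M](rmorph1 (horner_mx N)) -uv rmorphD !rmorphM/=.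
rewrite Cayley_Hamilton mulr0 add0r -mulmxE -mulmxA hK Cayley_Hamilton.
by rewrite !mulmx0.
Qed.

(** Pairing the equation with S gives tr (S M S) = 0, a sum of values of the
    positive definite form M at the columns of S. *)
Lemma lyapunov_eq0 p (M S : 'M[R]_p) :
  (forall x : 'cV[R]_p, x != 0 -> 0 < (x^T *m M *m x) 0 0) ->
  S^T = S -> S *m M + M *m S = 0 -> S = 0.
Proof.
move=> Mpos Ssym SM.
have quad j : (S *m M *m S) j j = ((col j S)^T *m M *m col j S) 0 0.
  rewrite tr_col Ssym -row_mul !mxE; apply: eq_bigr => i _.
  by rewrite [row _ _ _ _]mxE [col _ _ _ _]mxE.
have : \tr (S *m M *m S) = 0.
  have : \tr (S *m (S *m M + M *m S)) = 0 by rewrite SM mulmx0 mxtrace0.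
  rewrite mulmxDr mxtraceD [in X in X + _]mxtrace_mulC mulmxA -mulr2n.
  by move=> /eqP; rewrite mulrn_eq0/= => /eqP.
move=> /eqP; rewrite psumr_eq0 => [/allP S0|j _]; last first.
  rewrite quad; have [->|/Mpos/ltW//] := eqVneq (col j S) 0.
  by rewrite mulmx0 mxE.
apply/matrixP => i j.
have [/colP/(_ i)|/Mpos] := eqVneq (col j S) 0; first by rewrite !mxE.
by rewrite -quad (eqP (S0 j (mem_index_enum _))) ltxx.
Qed.

(** In the frame [V C] the matrix A is block diagonal, so the characteristic
    polynomials of its two blocks multiply to a separable polynomial and are
    coprime. *)
Lemma invariant_normal_eq0 p q (A : 'M[R]_(p + q)) (V Z : 'M[R]_(p + q, p))
    (C : 'M[R]_(p + q, q)) (M : 'M[R]_p) (lambda : 'I_(p + q) -> R) :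
  A^T = A -> injective lambda ->
  char_poly A = \prod_(i < p + q) ('X - (lambda i)%:P) ->
  V^T *m V = 1%:M -> C^T *m C = 1%:M -> V^T *m C = 0 ->
  A *m V = V *m M -> A *m Z = Z *m M -> V^T *m Z = 0 -> Z = 0.
Proof.
move=> Asym linj Achar VV CC VC AV AZ VZ.
have CV : C^T *m V = 0 by apply: trmx_inj; rewrite trmx_mul trmxK VC trmx0.
pose W : 'M[R]_(p + q) := row_mx V C.
have W1 : W^T *m W = 1%:M.
  by rewrite tr_row_mx mul_col_row VV CC CV VC -scalar_mx_block.
have W2 : V *m V^T + C *m C^T = 1%:M.
  by rewrite -mul_row_col -tr_row_mx; exact: mulmx1C.
pose N := C^T *m A *m C.
have CA : C^T *m A = N *m C^T.
  rewrite /N -[LHS]mulmx1 -W2 mulmxDr !mulmxA.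
  by rewrite -(mulmxA C^T A V) AV mulmxA CV !mul0mx add0r.
have AW : W^T *m A *m W = block_mx M 0 0 N.
  have VAC : V^T *m (A *m C) = 0.
    apply: trmx_inj; rewrite trmx0 !trmx_mul trmxK Asym -mulmxA AV mulmxA CV.
    by rewrite mul0mx.
  rewrite tr_row_mx mul_col_mx mul_col_row -!(mulmxA V^T) AV mulmxA VV mul1mx VAC.
  by have -> : C^T *m A *m V = 0 by rewrite CA -mulmxA CV mulmx0.
have cop : coprimep (char_poly N) (char_poly M).
  have /separable_coprime -> // : separable_poly (char_poly A).
    rewrite Achar -(big_map lambda xpredT (fun x => 'X - x%:P)).
    by rewrite separable_prod_XsubC map_inj_uniq// index_enum_uniq.
  by rewrite -(char_poly_orthogonal_conj A W1) AW char_poly_block_diag mulrC.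
have K0 : C^T *m Z = 0.
  by apply: (sylvester_eq0 cop); rewrite mulmxA -CA -!mulmxA AZ.
by rewrite -[Z]mul1mx -W2 mulmxDl -!mulmxA VZ K0 !mulmx0 addr0.
Qed.

End Spectrum.

Section EntrywiseLinear.
Context {R : realType}.

Lemma mxD_entry m n (A B : 'M[R]_(m, n)) i j : (A + B) i j = A i j + B i j.
Proof. by rewrite mxE. Qed.

Lemma mxN_entry m n (A : 'M[R]_(m, n)) i j : (- A) i j = - A i j.
Proof. by rewrite mxE. Qed.

Lemma mxZ_entry m n c (A : 'M[R]_(m, n)) i j : (c *: A) i j = c * A i j.
Proof. by rewrite mxE. Qed.

Lemma mx0_entry m n i j : (0 : 'M[R]_(m, n)) i j = 0.
Proof. by rewrite mxE. Qed.

Definition mxlinE := (mxD_entry, mxN_entry, mxZ_entry, mx0_entry).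

End EntrywiseLinear.

(* Linear identities between matrices are checked entry by entry.  The products
   are generalized first, so that they are not expanded into sums. *)
Ltac mxlin :=
  do ?[move: (_ *m _) => ?]; apply/matrixP => ? ?; rewrite !mxlinE; lra.

(** * Skew parts *)

Section SkewPart.
Context {R : realType} {p : nat}.
Implicit Types B S Q : 'M[R]_p.

Lemma tr_skew B : (skew B)^T = - skew B.
Proof. by apply/matrixP => i j; rewrite /skew !mxE; lra. Qed.

Lemma skew_eq0 B : skew B = 0 <-> B^T = B.
Proof.
split=> [/matrixP B0|Bs]; last by rewrite /skew Bs subrr scaler0.
by apply/matrixP => i j; have := B0 i j; rewrite /skew !mxE; lra.
Qed.

Lemma skew_anti B : B^T = - B -> skew B = B.
Proof. by rewrite /skew => ->; mxlin. Qed.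

Lemma skew_idem B : skew (skew B) = skew B.
Proof. exact/skew_anti/tr_skew. Qed.

Lemma skew_is_linear : linear (@skew R p).
Proof. by move=> a B C; apply/matrixP => i j; rewrite /skew !mxE; lra. Qed.

Lemma skewD B C : skew (B + C) = skew B + skew C.
Proof. by apply/matrixP => i j; rewrite /skew !mxE; lra. Qed.

Lemma skewN B : skew (- B) = - skew B.
Proof. by apply/matrixP => i j; rewrite /skew !mxE; lra. Qed.

Lemma skew_conj B Q : skew (Q^T *m B *m Q) = Q^T *m skew B *m Q.
Proof.
rewrite /skew -scalemxAr -scalemxAl; congr (_ *: _).
by rewrite mulmxBr mulmxBl !trmx_mul trmxK mulmxA.
Qed.

End SkewPart.

(** * The Newton system *)

Section LinearClosure.
Context {R : realType} {V : lmodType R}.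

Lemma linear_id : linear (id : V -> V).
Proof. by []. Qed.

Lemma linear_add m n (f g : V -> 'M[R]_(m, n)) :
  linear f -> linear g -> linear (fun Z => f Z + g Z).
Proof. by move=> fl gl a Y Z; rewrite fl gl; mxlin. Qed.

Lemma linear_opp m n (f : V -> 'M[R]_(m, n)) :
  linear f -> linear (fun Z => - f Z).
Proof. by move=> fl a Y Z; rewrite fl; mxlin. Qed.

Lemma linear_constl m n k (B : 'M[R]_(m, n)) (f : V -> 'M[R]_(n, k)) :
  linear f -> linear (fun Z => B *m f Z).
Proof. by move=> fl a Y Z; rewrite fl mulmxDr -scalemxAr. Qed.

Lemma linear_constr m n k (B : 'M[R]_(n, k)) (f : V -> 'M[R]_(m, n)) :
  linear f -> linear (fun Z => f Z *m B).
Proof. by move=> fl a Y Z; rewrite fl mulmxDl -scalemxAl. Qed.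

Lemma linear_tr m n (f : V -> 'M[R]_(m, n)) :
  linear f -> linear (fun Z => (f Z)^T).
Proof. by move=> fl a Y Z; rewrite fl linearP. Qed.

Lemma linear_skew n (f : V -> 'M[R]_n) :
  linear f -> linear (fun Z => skew (f Z)).
Proof. by move=> fl a Y Z; rewrite fl skew_is_linear. Qed.

End LinearClosure.

Section NewtonOperator.
Context {R : realType} {n p : nat}.
Implicit Types (A : 'M[R]_n) (X Y Z : 'M[R]_(n, p)).

Definition oja_lift A X : 'M[R]_(n, p) :=
  A *m X - X *m X^T *m A *m X
  - X *m skew (invmx (X^T *m X) *m X^T *m A *m X).

(** The derivative of [oja_lift A] at X in the direction Z. *)
Definition oja_jacobian A X Z : 'M[R]_(n, p) :=
  let G := invmx (X^T *m X) in
  A *m Z - Z *m X^T *m A *m X - X *m Z^T *m A *m X - X *m X^T *m A *m Z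
  - Z *m skew (G *m X^T *m A *m X)
  - X *m skew (- (G *m (X^T *m Z + Z^T *m X) *m G *m X^T *m A *m X)
               + G *m (Z^T *m A *m X + X^T *m A *m Z)).

(** The Newton system lives on the horizontal space at X, which varies with X.
    Adding the vertical part of Z turns it into a square system on the whole
    matrix space with the same solutions. *)
Definition newton_op A X Z : 'M[R]_(n, p) :=
  proj_h X (oja_jacobian A X Z) + X *m skew (invmx (X^T *m X) *m X^T *m Z).

(** Z - X S is normal to X exactly for S = (X^T X)^-1 X^T Z, and an orthonormal
    frame of the orthogonal complement spans the normal directions. *)
Lemma horizontalP X Z : (p <= n)%N -> X^T *m X \in unitmx ->
  horizontal X Z <-> skew (invmx (X^T *m X) *m X^T *m Z) = 0.
Proof.
move=> pn Xu; split=> [[C [S [K [CC XC Ssym ->]]]]|/skew_eq0 Ssym].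
  apply/skew_eq0; rewrite mulmxDr !mulmxA -(mulmxA _ X^T X) mulVmx// mul1mx.
  by rewrite -(mulmxA _ X^T C) XC mulmx0 mul0mx addr0.
have [|C CC XC] := exists_orthonormal_normal (k := n - p) X; first by rewrite subnKC.
set S := (invmx _ *m _ *m _) in Ssym.
exists C, S, (C^T *m (Z - X *m S)); split => //.
pose W := row_mx X C.
have XS : X^T *m (Z - X *m S) = 0.
  by rewrite mulmxBr /S !mulmxA mulmxV// mul1mx subrr.
suff WW D : X^T *m D = 0 -> C^T *m D = 0 -> D = 0 :> 'M[R]_(n, p).
  apply: subr0_eq; rewrite opprD addrA; apply: WW.
    by rewrite mulmxBr XS (mulmxA X^T C) XC mul0mx subrr.
  by rewrite mulmxBr (mulmxA C^T C) CC mul1mx subrr.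
move=> XD CD; have CX : C^T *m X = 0 by apply: trmx_inj; rewrite trmx_mul trmxK XC trmx0.
have gramW : W^T *m W = block_mx (X^T *m X) 0 0 1%:M.
  by rewrite tr_row_mx mul_col_row XC CX CC.
have Wu : W^T *m W \in unitmx.
  by rewrite unitmxE gramW det_ublock det1 mulr1 -unitmxE.
have pnE : (p + (n - p) = n)%N by rewrite subnKC.
have WL : row_free W^T.
  have := mxrank_unit Wu; rewrite /row_free => rW.
  by rewrite eqn_leq rank_leq_row -{1}rW mxrankM_maxl.
have WD : D^T *m W = 0.
  rewrite mul_mx_row -[X]trmxK -[C]trmxK -!trmx_mul XD CD !trmx0 row_mx0//.
have Wf : row_free W.
  by rewrite /row_free -mxrank_tr (eqP WL) pnE.
apply: trmx_inj; rewrite trmx0.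
by apply: (row_free_inj Wf); rewrite WD mul0mx.
Qed.

Lemma proj_h_horizontal X Y : X^T *m X \in unitmx ->
  skew (invmx (X^T *m X) *m X^T *m proj_h X Y) = 0.
Proof.
move=> Xu; rewrite /proj_h mulmxBr skewD skewN.
rewrite (mulmxA (_ *m X^T) X) -(mulmxA _ X^T X) mulVmx// mul1mx skew_idem.
by rewrite subrr.
Qed.

Lemma oja_lift_horizontal A X : A^T = A -> X^T *m X \in unitmx ->
  skew (invmx (X^T *m X) *m X^T *m oja_lift A X) = 0.
Proof.
move=> As Xu; rewrite /oja_lift !mulmxBr !skewD !skewN !mulmxA.
rewrite -(mulmxA _ X^T X) mulVmx// !mul1mx skew_idem.
have -> : skew (X^T *m A *m X) = 0.
  by apply/skew_eq0; rewrite !trmx_mul trmxK As mulmxA.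
by rewrite subr0 subrr.
Qed.

(** As [oja_lift A X] and the range of [proj_h X] are horizontal, taking the
    vertical part of the square system shows that Z is horizontal. *)
Lemma newton_opP A X Z : (p <= n)%N -> A^T = A -> X^T *m X \in unitmx ->
  newton_solution A X Z <-> newton_op A X Z = - oja_lift A X.
Proof.
move=> pn As Xu; split=> [[/horizontalP-/(_ pn Xu) hZ eqZ]|opZ].
  by rewrite /newton_op hZ mulmx0 addr0.
have hZ : skew (invmx (X^T *m X) *m X^T *m Z) = 0.
  have := oja_lift_horizontal As Xu.
  move=> /(congr1 -%R); rewrite oppr0 -skewN -mulmxN -opZ /newton_op mulmxDr skewD.
  rewrite proj_h_horizontal// add0r mulmxA -(mulmxA _ X^T X) mulVmx// mul1mx.
  by rewrite skew_idem.
split; first exact/horizontalP.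
by move: opZ; rewrite /newton_op hZ mulmx0 addr0.
Qed.

Lemma newton_op_linear A X : linear (newton_op A X).
Proof.
rewrite /newton_op /proj_h /oja_jacobian.
do ![apply: linear_id | apply: linear_constl | apply: linear_constr
    | apply: linear_add | apply: linear_opp
    | apply: linear_skew | apply: linear_tr ].
Qed.

HB.instance Definition _ A X := GRing.isLinear.Build R 'M[R]_(n, p) 'M[R]_(n, p)
  _ (newton_op A X) (newton_op_linear A X).

(** The Newton system is equivariant under the right action of the orthogonal
    group. *)
Section Equivariance.
Variable Q : 'M[R]_p.
Hypothesis QQ : Q^T *m Q = 1%:M.

Let mulmxKQ m (Y : 'M[R]_(m, p)) : Y *m Q *m Q^T = Y.
Proof. by rewrite -mulmxA (mulmx1C QQ) mulmx1. Qed.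

Lemma gram_mulQ X : (X *m Q)^T *m (X *m Q) = Q^T *m (X^T *m X) *m Q.
Proof. by rewrite trmx_mul !mulmxA. Qed.

Lemma gram_mulQ_unit X :
  ((X *m Q)^T *m (X *m Q) \in unitmx) = (X^T *m X \in unitmx).
Proof.
have Qu : Q \in unitmx by case: (mulmx1_unit QQ).
by rewrite gram_mulQ !unitmx_mul unitmx_tr Qu andbT.
Qed.

Lemma invmx_gram_mulQ X : X^T *m X \in unitmx ->
  invmx ((X *m Q)^T *m (X *m Q)) = Q^T *m invmx (X^T *m X) *m Q.
Proof.
move=> Xu; have XQu := Xu; rewrite -gram_mulQ_unit in XQu.
rewrite -[RHS](mulKmx XQu) gram_mulQ; move: (X^T *m X) Xu {XQu} => P Pu.
by rewrite !mulmxA mulmxKQ mulmxK// -(mulmxA _ Q^T Q) QQ mulmx1.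
Qed.

Lemma oja_lift_mulQ A X : X^T *m X \in unitmx ->
  oja_lift A (X *m Q) = oja_lift A X *m Q.
Proof.
move=> Xu; rewrite /oja_lift invmx_gram_mulQ//.
rewrite [X in skew X](_ : _ = Q^T *m (invmx (X^T *m X) *m X^T *m A *m X) *m Q);
  last by rewrite trmx_mul !mulmxA !mulmxKQ.
by rewrite skew_conj trmx_mul !mulmxBl !mulmxA !mulmxKQ.
Qed.

Lemma newton_op_mulQ A X Z : X^T *m X \in unitmx ->
  newton_op A (X *m Q) (Z *m Q) = newton_op A X Z *m Q.
Proof.
move=> Xu; have jacQ : oja_jacobian A (X *m Q) (Z *m Q) = oja_jacobian A X Z *m Q.
  rewrite /oja_jacobian invmx_gram_mulQ//; set G := invmx _.
  rewrite [B in _ - Z *m Q *m skew B - _](_ : _ =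
    Q^T *m (G *m X^T *m A *m X) *m Q); last by rewrite trmx_mul !mulmxA !mulmxKQ.
  rewrite [B in _ - X *m Q *m skew B](_ : _ =
    Q^T *m (- (G *m (X^T *m Z + Z^T *m X) *m G *m X^T *m A *m X)
               + G *m (Z^T *m A *m X + X^T *m A *m Z)) *m Q); last first.
    by rewrite !trmx_mul !(mulmxDl, mulmxDr, mulmxN, mulNmx) !mulmxA !mulmxKQ.
  by rewrite !skew_conj !trmx_mul !mulmxBl !mulmxA !mulmxKQ.
rewrite /newton_op /proj_h jacQ invmx_gram_mulQ//; set G := invmx _.
have skQ Y : skew (Q^T *m G *m Q *m (X *m Q)^T *m (Y *m Q)) =
    Q^T *m skew (G *m X^T *m Y) *m Q.
  by rewrite -skew_conj trmx_mul !mulmxA !mulmxKQ.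
rewrite !skQ; move: (oja_jacobian A X Z) => J.
by rewrite mulmxDl mulmxBl !mulmxA !mulmxKQ.
Qed.

End Equivariance.

End NewtonOperator.

(** * First-order expansions *)

(** A row v with v P = 0 satisfies v = v (1 - P), hence |v| <= |v| / 2. *)
Lemma near1_unitmx {R : realType} n (P : 'M[R]_n) :
  n%:R * `|1%:M - P| <= 2^-1 -> P \in unitmx.
Proof.
move=> P1; rewrite -row_free_unit -kermx_eq0; apply/rowV0P => v /sub_kermxP vP.
apply/eqP; rewrite -normr_le0.
have : `|v| <= n%:R * `|v| * `|1%:M - P|.
  have {1}<- : v *m (1%:M - P) = v by rewrite mulmxBr mulmx1 vP subr0.
  exact: mulmx_norm_le.
have := ler_wpM2r (normr_ge0 v) P1.
set x := `|v|; set y := `|1%:M - _|; lra.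
Qed.

(** A calculus of first-order expansions of matrix-valued functions: [f] is
    compared with a main part [f0] and a correction [f1] of order one in the
    small parameter [a], up to order two. *)
Section Jets.
Context {R : realType} {T : Type} (D : set T) (a : T -> R).
Hypothesis a_ge0 : forall t, D t -> 0 <= a t.
Hypothesis a_le1 : forall t, D t -> a t <= 1.

Definition bigOh k m n (f : T -> 'M[R]_(m, n)) : Prop :=
  exists2 C, 0 <= C & forall t, D t -> `|f t| <= C * a t ^+ k.

Lemma bigOh_eq k m n (f g : T -> 'M[R]_(m, n)) :
  (forall t, D t -> f t = g t) -> bigOh k f -> bigOh k g.
Proof. by move=> fg [C C0 fC]; exists C => // t Dt; rewrite -fg// fC. Qed.

Lemma bigOhW k l m n (f : T -> 'M[R]_(m, n)) :
  (k <= l)%N -> bigOh l f -> bigOh k f.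
Proof.
move=> kl [C C0 fC]; exists C => // t Dt; rewrite (le_trans (fC t Dt))//.
by rewrite ler_wpM2l// ler_wiXn2l ?a_ge0 ?a_le1.
Qed.

Lemma bigOh_cst m n (M : 'M[R]_(m, n)) : bigOh 0 (fun=> M).
Proof. by exists `|M| => // t _; rewrite expr0 mulr1. Qed.

Lemma bigOh0 k m n : bigOh k (fun=> 0 : 'M[R]_(m, n)).
Proof. by exists 0 => // t _; rewrite normr0 mul0r. Qed.

Lemma bigOhD k m n (f g : T -> 'M[R]_(m, n)) :
  bigOh k f -> bigOh k g -> bigOh k (fun t => f t + g t).
Proof.
move=> [C C0 fC] [B B0 gB]; exists (C + B); first exact: addr_ge0.
by move=> t Dt; rewrite (le_trans (ler_normD _ _))// mulrDl lerD ?fC ?gB.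
Qed.

Lemma bigOhN k m n (f : T -> 'M[R]_(m, n)) :
  bigOh k f -> bigOh k (fun t => - f t).
Proof. by move=> [C C0 fC]; exists C => // t Dt; rewrite normrN fC. Qed.

Lemma bigOhM k l m n q (f : T -> 'M[R]_(m, n)) (g : T -> 'M[R]_(n, q)) :
  bigOh k f -> bigOh l g -> bigOh (k + l) (fun t => f t *m g t).
Proof.
move=> [C C0 fC] [B B0 gB]; exists (n%:R * C * B); first by rewrite !mulr_ge0.
move=> t Dt; rewrite (le_trans (mulmx_norm_le _ _))// exprD.
have -> : n%:R * C * B * (a t ^+ k * a t ^+ l) =
  n%:R * (C * a t ^+ k) * (B * a t ^+ l) by ring.
by rewrite ler_pM ?mulr_ge0 ?gB// ler_wpM2l ?fC.
Qed.

Lemma bigOhT k m n (f : T -> 'M[R]_(m, n)) :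
  bigOh k f -> bigOh k (fun t => (f t)^T).
Proof. by move=> [C C0 fC]; exists C => // t Dt; rewrite trmx_norm fC. Qed.

Lemma bigOhZ k m n c (f : T -> 'M[R]_(m, n)) :
  bigOh k f -> bigOh k (fun t => c *: f t).
Proof.
move=> [C C0 fC]; exists (`|c| * C); first exact: mulr_ge0.
by move=> t Dt; rewrite normrZ -mulrA ler_wpM2l ?fC.
Qed.

Definition jet m n (f f0 f1 : T -> 'M[R]_(m, n)) : Prop :=
  [/\ bigOh 0 f0, bigOh 1 f1 & bigOh 2 (fun t => f t - f0 t - f1 t)].

Lemma jet_eq m n (f f0 f1 g0 g1 : T -> 'M[R]_(m, n)) : jet f f0 f1 ->
  (forall t, D t -> f0 t = g0 t) -> (forall t, D t -> f1 t = g1 t) ->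
  jet f g0 g1.
Proof.
move=> [f0O f1O f2O] e0 e1; split; [exact: bigOh_eq f0O | exact: bigOh_eq f1O |].
by apply: bigOh_eq f2O => t Dt; rewrite e0 ?e1.
Qed.

Lemma jet_sub0 m n (f f0 f1 : T -> 'M[R]_(m, n)) :
  jet f f0 f1 -> bigOh 1 (fun t => f t - f0 t).
Proof.
move=> [_ f1O /(bigOhW (isT : 1 <= 2)%N) /bigOhD/(_ f1O)].
by apply: bigOh_eq => t _; rewrite subrK.
Qed.

Lemma jet_bounded m n (f f0 f1 : T -> 'M[R]_(m, n)) : jet f f0 f1 -> bigOh 0 f.
Proof.
move=> fj; have [f0O _ _] := fj; have /(bigOhW (leq0n 1)) /bigOhD/(_ f0O) := jet_sub0 fj.
by apply: bigOh_eq => t _; rewrite subrK.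
Qed.

Lemma jet_cst m n (M : 'M[R]_(m, n)) : jet (fun=> M) (fun=> M) (fun=> 0).
Proof.
split; [exact: bigOh_cst | exact: bigOh0 | apply: bigOh_eq (@bigOh0 2 m n) => t _].
by rewrite subrr subr0.
Qed.

Lemma jet_main m n (f : T -> 'M[R]_(m, n)) : bigOh 0 f -> jet f f (fun=> 0).
Proof.
split => //; first exact: bigOh0.
by apply: bigOh_eq (@bigOh0 2 m n) => t _; rewrite subrr subr0.
Qed.

Lemma jetD m n (f f0 f1 g g0 g1 : T -> 'M[R]_(m, n)) :
  jet f f0 f1 -> jet g g0 g1 ->
  jet (fun t => f t + g t) (fun t => f0 t + g0 t) (fun t => f1 t + g1 t).
Proof.
move=> [f0O f1O f2O] [g0O g1O g2O]; split; [exact: bigOhD | exact: bigOhD |].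
apply: bigOh_eq (bigOhD f2O g2O) => t _; mxlin.
Qed.

Lemma jetN m n (f f0 f1 : T -> 'M[R]_(m, n)) :
  jet f f0 f1 -> jet (fun t => - f t) (fun t => - f0 t) (fun t => - f1 t).
Proof.
move=> [f0O f1O f2O]; split; [exact: bigOhN | exact: bigOhN |].
apply: bigOh_eq (bigOhN f2O) => t _; mxlin.
Qed.

Lemma jetZ m n c (f f0 f1 : T -> 'M[R]_(m, n)) :
  jet f f0 f1 -> jet (fun t => c *: f t) (fun t => c *: f0 t) (fun t => c *: f1 t).
Proof.
move=> [f0O f1O f2O]; split; [exact: bigOhZ | exact: bigOhZ |].
apply: bigOh_eq (bigOhZ c f2O) => t _; rewrite !scalerBr; mxlin.
Qed.

Lemma jetT m n (f f0 f1 : T -> 'M[R]_(m, n)) :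
  jet f f0 f1 -> jet (fun t => (f t)^T) (fun t => (f0 t)^T) (fun t => (f1 t)^T).
Proof.
move=> [f0O f1O f2O]; split; [exact: bigOhT | exact: bigOhT |].
by apply: bigOh_eq (bigOhT f2O) => t _; rewrite !linearB.
Qed.

Lemma jetM m n q (f f0 f1 : T -> 'M[R]_(m, n)) (g g0 g1 : T -> 'M[R]_(n, q)) :
  jet f f0 f1 -> jet g g0 g1 ->
  jet (fun t => f t *m g t) (fun t => f0 t *m g0 t)
      (fun t => f0 t *m g1 t + f1 t *m g0 t).
Proof.
move=> [f0O f1O f2O] gj; have gO := jet_bounded gj; have [g0O g1O g2O] := gj.
split; [exact: (bigOhM f0O g0O) | |].
  by apply: bigOhD; [exact: (bigOhM f0O g1O) | exact: (bigOhM f1O g0O)].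
have := bigOhD (bigOhM f2O gO) (bigOhD (bigOhM f0O g2O) (bigOhM f1O (jet_sub0 gj))).
apply: bigOh_eq => t _; rewrite !(mulmxBl, mulmxBr); mxlin.
Qed.

Lemma jet_skew n (f f0 f1 : T -> 'M[R]_n) : jet f f0 f1 ->
  jet (fun t => skew (f t)) (fun t => skew (f0 t)) (fun t => skew (f1 t)).
Proof.
move=> fj; have := jetZ 2^-1 (jetD fj (jetN (jetT fj))).
by move/jet_eq; apply.
Qed.

(** From P^-1 = 1 + P^-1 (1 - P), used twice. *)
Lemma jet_invmx n (P P1 : T -> 'M[R]_n) : jet P (fun=> 1%:M) P1 ->
  (forall t, D t -> n%:R * `|1%:M - P t| <= 2^-1) ->
  jet (fun t => invmx (P t)) (fun=> 1%:M) (fun t => - P1 t).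
Proof.
move=> Pj Psmall; have [_ P1O P2O] := Pj.
have Pu t : D t -> P t \in unitmx by move=> /Psmall/near1_unitmx.
have invE t : D t -> invmx (P t) = 1%:M + invmx (P t) *m (1%:M - P t).
  by move=> Dt; rewrite mulmxBr mulmx1 mulVmx ?Pu// addrC subrK.
have invO : bigOh 0 (fun t => invmx (P t)).
  exists 2 => // t Dt; rewrite expr0 mulr1.
  have := ler_normD 1%:M (invmx (P t) *m (1%:M - P t)); rewrite -invE//.
  have := mulmx_norm_le (invmx (P t)) (1%:M - P t).
  have : `|1%:M : 'M[R]_n| <= 1 by apply: orthonormal_norm_le1; rewrite trmx1 mulmx1.
  have := ler_wpM2l (normr_ge0 (invmx (P t))) (Psmall t Dt).
  set x := `|invmx _|; set y := `|1%:M - _|; set z := `|_ *m _|; lra.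
have PO : bigOh 1 (fun t => 1%:M - P t).
  by apply: bigOh_eq (bigOhN (jet_sub0 Pj)) => t _; rewrite opprB.
have inv1O : bigOh 1 (fun t => invmx (P t) - 1%:M).
  apply: bigOh_eq (bigOhM invO PO) => t Dt.
  by apply/esym; rewrite {1}invE// addrAC subrr add0r.
split; [exact: bigOh_cst | exact: bigOhN |].
apply: bigOh_eq (bigOhD (bigOhM inv1O PO) (bigOhN P2O)) => t Dt.
rewrite mulmxBl mul1mx [in RHS]invE//; mxlin.
Qed.

End Jets.

(** * The local estimate at an orthonormal basis *)

(** Inverting a perturbation: if c bounds the inverse and the perturbation b is
    at most 1/(2c), the perturbed inverse is bounded by 2c. *)
Lemma absorb_half {R : realFieldType} (c x v z b : R) : 0 <= c -> 0 <= z ->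
  2 * c * b <= 1 -> z <= c * v -> v <= x + b * z -> z <= 2 * c * x.
Proof.
move=> c0 z0 cb zc vx; have := ler_wpM2l c0 vx; have := ler_wpM2r z0 cb; lra.
Qed.

Section LocalNewton.
Context {R : realType} {n p : nat}.
Variables (A : 'M[R]_n) (V : 'M[R]_(n, p)).
Hypothesis VV : V^T *m V = 1%:M.

(* Pairs (Delta, Z): the point V + Delta is close to V, and Z is a direction,
   normalized because [newton_op] is linear in it. *)
Let D : set ('M[R]_(n, p) * 'M[R]_(n, p)) := [set t |
  [/\ `|t.1| <= 1, `|t.2| <= 1 &
      p%:R * `|1%:M - (V + t.1)^T *m (V + t.1)| <= 2^-1]].

Let small (t : 'M[R]_(n, p) * 'M[R]_(n, p)) : R := `|t.1|.

Let small_ge0 t : D t -> 0 <= small t. Proof. by move=> _; exact: normr_ge0. Qed.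
Let small_le1 t : D t -> small t <= 1. Proof. by move=> [t1 _ _]; exact: t1. Qed.

Let jet_point : jet D small (fun t => V + t.1) (fun=> V) (fun t => t.1).
Proof.
split; first exact: bigOh_cst.
  by exists 1 => // t _; rewrite mul1r expr1.
by apply: (bigOh_eq _ (bigOh0 _ _ 2 n p)) => t _; mxlin.
Qed.

Let jet_dir : jet D small (fun t => t.2) (fun t => t.2) (fun=> 0).
Proof.
by apply: jet_main; exists 1 => // t [_ ? _]; rewrite expr0 mulr1.
Qed.

Let jet_gram_inv : jet D small (fun t => invmx ((V + t.1)^T *m (V + t.1)))
  (fun=> 1%:M) (fun t => - (V^T *m t.1 + t.1^T *m V)).
Proof.
apply: (jet_invmx small_ge0 small_le1) => [|t [] //].
by apply: (jet_eq (jetM small_ge0 small_le1 (jetT jet_point) jet_point)) => // t _.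
Qed.

(* Expansions are computed by following the syntax of the function. *)
Ltac jets := lazymatch goal with
  | |- jet _ _ (fun t => V + fst t) _ _ => exact jet_point
  | |- jet _ _ (fun t => snd t) _ _ => exact jet_dir
  | |- jet _ _ (@snd _ _) _ _ => exact jet_dir
  | |- jet _ _ (fun t => invmx _) _ _ => exact jet_gram_inv
  | |- jet _ _ (fun _ => ?M) _ _ => exact (jet_cst _ _ M)
  | |- jet _ _ (fun t => skew _) _ _ => eapply jet_skew; jets
  | |- jet _ _ (fun t => trmx _) _ _ => eapply jetT; jets
  | |- jet _ _ (fun t => - _) _ _ => eapply jetN; jets
  | |- jet _ _ (fun t => _ + _) _ _ => eapply jetD; jets
  | |- jet _ _ (fun t => _ *m _) _ _ =>
      eapply (jetM small_ge0 small_le1); jets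
  end.

Lemma oja_lift_expansion :
  jet D small (fun t => oja_lift A (V + t.1)) (fun=> oja_lift A V)
    (fun t => oja_jacobian A V t.1).
Proof.
rewrite /oja_lift /oja_jacobian VV invmx1.
eapply jet_eq.
- jets.
- by move=> t _ /=; rewrite !mul1mx.
- move=> t _ /=; rewrite !(mul0mx, mulmx0, mulmx1, mul1mx, add0r).
  rewrite !(mulmxDl, mulmxDr, mulNmx, mulmxN) ?mulmxA.
  by rewrite !(skewD, skewN) !(mulmxDr, mulmxN); mxlin.
Qed.

Lemma newton_op_expansion :
  bigOh D small 1 (fun t => newton_op A (V + t.1) t.2 - newton_op A V t.2).
Proof.
have [f1 /(jet_sub0 small_ge0 small_le1)//] : exists f1, jet D small
    (fun t => newton_op A (V + t.1) t.2) (fun t => newton_op A V t.2) f1.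
eexists; rewrite /newton_op /proj_h /oja_jacobian; eapply jet_eq.
- jets.
- by move=> t _ /=; rewrite VV invmx1 !mul1mx.
- by [].
Qed.

Variable M : 'M[R]_p.
Hypothesis A_sym : A^T = A.
Hypothesis AV : A *m V = V *m M.
Hypothesis M_posdef : forall x : 'cV[R]_p, x != 0 -> 0 < (x^T *m M *m x) 0 0.
Hypothesis normal_inj :
  forall Z : 'M[R]_(n, p), V^T *m Z = 0 -> A *m Z = Z *m M -> Z = 0.

Lemma compressionE : V^T *m A *m V = M.
Proof. by rewrite -mulmxA AV mulmxA VV mul1mx. Qed.

Lemma compression_sym : M^T = M.
Proof. by rewrite -compressionE !trmx_mul trmxK A_sym mulmxA. Qed.

Lemma trV_A : V^T *m A = M *m V^T.
Proof. by apply: trmx_inj; rewrite !trmx_mul trmxK A_sym compression_sym. Qed.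

Lemma oja_lift_base : oja_lift A V = 0.
Proof.
rewrite /oja_lift VV invmx1 mul1mx compressionE.
rewrite (skew_eq0 M).2 ?compression_sym// mulmx0 -!mulmxA (mulmxA V^T) compressionE.
by rewrite AV subrr subr0.
Qed.

Lemma oja_jacobian_base (Z : 'M[R]_(n, p)) : (V^T *m Z)^T = V^T *m Z ->
  oja_jacobian A V Z =
    A *m Z - Z *m M - 2 *: (V *m (M *m (V^T *m Z))).
Proof.
move SE : (V^T *m Z) => S Ssym.
have ZV : Z^T *m V = S by rewrite -Ssym -SE trmx_mul trmxK.
have ZAV : Z^T *m A *m V = S *m M by rewrite -mulmxA AV mulmxA ZV.
have VAZ : V^T *m A *m Z = M *m S by rewrite trV_A -mulmxA SE.
have skM : skew M = 0 by apply/skew_eq0/compression_sym.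
have skSM : skew (M *m S - S *m M) = M *m S - S *m M.
  by apply: skew_anti; rewrite linearB/= !trmx_mul Ssym compression_sym opprB.
have e1 : Z *m V^T *m A *m V = Z *m M.
  by rewrite -!mulmxA (mulmxA V^T) compressionE.
have e2 : V *m Z^T *m A *m V = V *m (S *m M).
  by rewrite -!mulmxA (mulmxA Z^T) ZAV.
have e3 : V *m V^T *m A *m Z = V *m (M *m S).
  by rewrite -!mulmxA (mulmxA V^T) VAZ.
have e4 : (S + S) *m V^T *m A *m V = S *m M + S *m M.
  by rewrite -!mulmxA (mulmxA V^T) compressionE mulmxDl.
rewrite /oja_jacobian VV invmx1 !mul1mx compressionE skM mulmx0 mulmx1.
rewrite SE e1 e2 e3 ZV e4 ZAV VAZ.
rewrite [X in skew X](_ : _ = M *m S - S *m M); last by mxlin.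
by rewrite skSM mulmxBr; mxlin.
Qed.

Lemma newton_op_base (Z : 'M[R]_(n, p)) : (V^T *m Z)^T = V^T *m Z ->
  newton_op A V Z = oja_jacobian A V Z.
Proof.
move=> Ssym; rewrite /newton_op /proj_h VV invmx1 !mul1mx.
rewrite (skew_eq0 (V^T *m Z)).2// mulmx0 addr0 (skew_eq0 _).2 ?mulmx0 ?subr0//.
rewrite oja_jacobian_base// !mulmxBr -scalemxAr (mulmxA V^T V) VV mul1mx.
rewrite !(mulmxA V^T) trV_A -(mulmxA M); move: (V^T *m Z) Ssym => S Ssym.
rewrite linearB linearB/= linearZ/= !trmx_mul Ssym compression_sym; mxlin.
Qed.

(** On the normal directions at V the system is a Sylvester equation, on the
    symmetric ones a Lyapunov equation. *)
Lemma newton_op_base_inj (Z : 'M[R]_(n, p)) : newton_op A V Z = 0 -> Z = 0.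
Proof.
move=> opZ; have Ssym : (V^T *m Z)^T = V^T *m Z.
  apply/skew_eq0; have := congr1 (fun Y => skew (invmx (V^T *m V) *m V^T *m Y)) opZ.
  rewrite /newton_op mulmxDr skewD proj_h_horizontal ?VV ?unitmx1// add0r.
  by rewrite invmx1 !mul1mx mulmxA VV mul1mx skew_idem mulmx0 => ->; apply/skew_eq0/trmx0.
move: opZ; rewrite newton_op_base// oja_jacobian_base// => jac0.
have S0 : V^T *m Z = 0.
  apply: (lyapunov_eq0 M_posdef) => //.
  have := congr1 (mulmx V^T) jac0.
  rewrite !mulmxBr -scalemxAr (mulmxA V^T V) VV mul1mx mulmx0.
  rewrite !(mulmxA V^T) trV_A -(mulmxA M); move: (V^T *m Z) => S /matrixP eS.
  by apply/matrixP => i j; have := eS i j; rewrite !mxlinE; lra.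
apply: normal_inj => //; apply: subr0_eq.
by move: jac0; rewrite S0 !mulmx0 scaler0 subr0.
Qed.

(** Uniform invertibility of the system near V gives the first two claims.  For
    the third, [newton_op A X] applied to Z + (X - V) equals
    - oja_lift A X + newton_op A X (X - V), which is of second order by the
    expansions of both terms at V. *)
Lemma newton_local : (p <= n)%N -> exists r C : R, [/\ 0 < r, 0 <= C &
  forall X : 'M[R]_(n, p), `|X - V| <= r ->
  [/\ X^T *m X \in unitmx,
      exists Z, unique (newton_solution A X) Z &
      (V^T *m X)^T = V^T *m X -> forall Z, newton_solution A X Z ->
        `|X + Z - V| <= C * `|X - V| ^+ 2]].
Proof.
move=> pn.
have [C1 C1_ge0 op_near] := newton_op_expansion.
have [_ _ [C2 C2_ge0 lift_near]] := oja_lift_expansion.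
have [_ [c0 c0_ge0 op_below]] := injective_linear_mx (f := newton_op A V) newton_op_base_inj.
(* The radius 1/N makes X^T X invertible (6 n p), and the perturbation of the
   operator at most half of its lower bound (2 c0 C1). *)
set N : R := 1 + 6 * n%:R * p%:R + 2 * c0 * C1.
have N_gt0 : 0 < N by rewrite /N -addrA ltr_pwDl// addr_ge0// !mulr_ge0.
exists N^-1, (2 * c0 * (C1 + C2)); split; first by rewrite invr_gt0.
  by rewrite !mulr_ge0// addr_ge0.
move=> X; set Delta := X - V => Delta_small.
have XE : X = V + Delta by rewrite addrC subrK.
have [d0 dN] : 0 <= `|Delta| /\ `|Delta| * N <= 1.
  by rewrite -ler_pdivlMr// div1r.
have [d1 d2 d3] : [/\ `|Delta| <= 1, 6 * n%:R * p%:R * `|Delta| <= 1 &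
    2 * c0 * C1 * `|Delta| <= 1].
  have x1 : 0 <= 6 * n%:R * p%:R * `|Delta| by rewrite !mulr_ge0.
  have x2 : 0 <= 2 * c0 * C1 * `|Delta| by rewrite !mulr_ge0.
  by move: dN; rewrite /N => dN; split; lra.
have gram_near : p%:R * `|1%:M - (V + Delta)^T *m (V + Delta)| <= 2^-1.
  have -> : 1%:M - (V + Delta)^T *m (V + Delta) =
      - (V^T *m Delta + Delta^T *m V + Delta^T *m Delta).
    rewrite [(V + _)^T]linearD/= !(mulmxDl, mulmxDr) VV; mxlin.
  rewrite normrN; have V1 := orthonormal_norm_le1 VV.
  have VD : `|V^T *m Delta| <= n%:R * `|Delta|.
    rewrite (le_trans (mulmx_norm_le _ _))// trmx_norm ler_wpM2r// ler_piMr//.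
  have DV : `|Delta^T *m V| <= n%:R * `|Delta|.
    by rewrite -trmx_norm trmx_mul trmxK.
  have DD : `|Delta^T *m Delta| <= n%:R * `|Delta|.
    rewrite (le_trans (mulmx_norm_le _ _))// trmx_norm ler_wpM2r// ler_piMr//.
  have sumle : `|V^T *m Delta + Delta^T *m V + Delta^T *m Delta| <= 3 * n%:R * `|Delta|.
    have := ler_normD (V^T *m Delta + Delta^T *m V) (Delta^T *m Delta).
    have := ler_normD (V^T *m Delta) (Delta^T *m V); lra.
  have := ler_wpM2l (ler0n R p) sumle; lra.
have inD Z : `|Z| <= 1 -> D (Delta, Z) by [].
have op_lip Z : `|newton_op A X Z - newton_op A V Z| <= C1 * `|Delta| * `|Z|.
  have [->|Z0] := eqVneq Z 0.
    by rewrite !raddf0 addr0 !normr0 mulr0.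
  have Zn : 0 < `|Z| by rewrite normr_gt0.
  have Z1 : `| `|Z|^-1 *: Z | <= 1.
    by rewrite normrZ gtr0_norm ?invr_gt0// mulVf ?gt_eqF.
  have := op_near (Delta, `|Z|^-1 *: Z) (inD _ Z1); rewrite /small/= -XE expr1.
  have -> : newton_op A X (`|Z|^-1 *: Z) - newton_op A V (`|Z|^-1 *: Z) =
    `|Z|^-1 *: (newton_op A X Z - newton_op A V Z) by rewrite scalerBr !linearZ.
  by rewrite normrZ gtr0_norm ?invr_gt0// ler_pdivrMl// [_ * `|Z|]mulrC.
have X_below Z : `|Z| <= 2 * c0 * `|newton_op A X Z|.
  have b0 : 2 * c0 * (C1 * `|Delta|) <= 1 by rewrite mulrA.
  apply: (absorb_half c0_ge0 (normr_ge0 Z) b0 (op_below Z)).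
  have := ler_normB (newton_op A X Z) (newton_op A X Z - newton_op A V Z).
  rewrite opprB addrC subrK => /le_trans; apply; rewrite lerD2l; exact: op_lip.
have Xu : X^T *m X \in unitmx by apply: near1_unitmx; rewrite XE.
have [|op_surj _] := injective_linear_mx (f := newton_op A X).
  move=> Z Z0; apply/eqP; rewrite -normr_le0; have := X_below Z.
  by rewrite (Z0 : newton_op A X Z = 0) normr0 mulr0.
split => //.
  have [Z eqZ] := op_surj (- oja_lift A X); exists Z; split; first exact/newton_opP.
  move=> Z' /(newton_opP _ pn A_sym Xu) eqZ'; apply/subr0_eq/eqP; rewrite -normr_le0.
  have := X_below (Z - Z'); rewrite raddfB/=.
  by rewrite eqZ eqZ' subrr normr0 mulr0.
move=> VXsym Z /(newton_opP _ pn A_sym Xu) eqZ.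
have VDsym : (V^T *m Delta)^T = V^T *m Delta.
  by rewrite mulmxBr linearB/= VXsym VV trmx1.
rewrite -addrAC; rewrite (le_trans (X_below _))// -!mulrA !ler_wpM2l//.
rewrite raddfD/= eqZ.
have := lift_near (Delta, 0) (inD _ _); rewrite /small/= -XE oja_lift_base normr0.
move=> /(_ ler01); rewrite subr0 -newton_op_base// => le1.
have := op_lip Delta; rewrite -mulrA -expr2 mulrDl => le2.
move: (newton_op A X Delta) (newton_op A V Delta) (oja_lift A X) le1 le2.
move=> x v l le1 le2; have -> : x - l = (x - v) - (l - v) by mxlin.
by rewrite (le_trans (ler_normB _ _))// lerD.
Qed.

End LocalNewton.

(** * Square roots near the identity *)

HB.instance Definition _ (R : realType) m n :=
  Uniform_isComplete.Build 'M[R]_(m, n) (@cauchy_cvg 'M[R]_(m, n)).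

Section SquareRoot.
Context {R : realType} {p : nat}.

Lemma closed_symmetric_ball (e : R) :
  closed [set D : 'M[R]_p | D^T = D /\ `|D| <= e].
Proof.
pose sk : {linear 'M[R]_p -> 'M[R]_p} := HB.pack (@Defs.skew R p)
  (GRing.isLinear.Build _ _ _ _ _ (@skew_is_linear R p)).
have -> : [set D : 'M[R]_p | D^T = D /\ `|D| <= e] =
    (fun D => `|sk D|) @^-1` [set x | x <= 0] `&` Num.norm @^-1` [set x | x <= e].
  apply/seteqP; split=> D /= [].
    by move=> /skew_eq0 D0 De; rewrite D0 normr0.
  by rewrite normr_le0 => /eqP /skew_eq0.
apply: closedI; apply: closed_comp => //; try exact: closed_le; move=> D _.
  apply: continuous_comp; first exact: linear_mx_continuous.
  exact: norm_continuous.
exact: norm_continuous.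
Qed.

(** The root 1 + D is found as the fixed point of D |-> (E - D^2)/2, which is a
    contraction on the symmetric matrices of norm at most |E|. *)
Lemma sqrt_near1 (E : 'M[R]_p) : E^T = E -> p%:R * `|E| <= 2^-1 ->
  exists D : 'M[R]_p,
    [/\ D^T = D, `|D| <= `|E| & (1%:M + D) *m (1%:M + D) = 1%:M + E].
Proof.
move=> Esym Esmall; pose U := [set D : 'M[R]_p | D^T = D /\ `|D| <= `|E|].
pose f (D : 'M[R]_p) : 'M[R]_p := 2^-1 *: (E - D *m D).
have mul_le (D D' : 'M[R]_p) : `|D| <= `|E| -> `|D *m D'| <= 2^-1 * `|D'|.
  move=> DE; rewrite (le_trans (mulmx_norm_le _ _))// ler_wpM2r//.
  by rewrite (le_trans _ Esmall)// ler_wpM2l.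
have fU : set_fun U U f.
  move=> D [Dsym DE]; split.
    by rewrite /f linearZ/= linearB/= trmx_mul Dsym Esym.
  rewrite /f normrZ gtr0_norm ?invr_gt0//.
  have := normr_ge0 E; have := ler_normB E (D *m D); have := mul_le _ D DE.
  move: DE; move: `|D| `|E| `|_ *m _| `|E - _| => x y z t; lra.
pose F : {fun U >-> U} := HB.pack f (isFun.Build _ _ U U f fU).
have Fcontr : is_contraction F.
  exists 2^-1%:nng; split => /=; first lra.
  move=> [D D'] /= [[Dsym DE] [D'sym D'E]].
  have -> : f D - f D' = 2^-1 *: (D' *m (D' - D) + ((D' - D) *m D)).
    by rewrite /f mulmxBr mulmxBl; mxlin.
  have le1 := mul_le _ (D' - D) D'E.
  have le2 : `|(D' - D) *m D| <= 2^-1 * `|D' - D|.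
    rewrite (le_trans (mulmx_norm_le _ _))// mulrAC ler_wpM2r//.
    by rewrite (le_trans _ Esmall)// ler_wpM2l.
  rewrite normrZ gtr0_norm ?invr_gt0// ler_wpM2l// [leRHS]distrC.
  have := ler_normD (D' *m (D' - D)) ((D' - D) *m D); move: le1 le2.
  move: `|_ *m _| `|_ *m D| `|D' - D| `|_ + _| => x y z t; lra.
have Ucl : closed U by exact: closed_symmetric_ball.
have [|D [Dsym DE] Dfix] := banach_fixed_point Fcontr Ucl.
  by exists 0; split; rewrite ?trmx0 ?normr0.
exists D; split => //; rewrite mulmxDl mul1mx mulmxDr mulmx1.
have /matrixP Dfix' : D = 2^-1 *: (E - D *m D) := Dfix.
apply/matrixP => i j; have := Dfix' i j; rewrite !mxlinE; lra.
Qed.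

End SquareRoot.

(** * The lower part of a symmetric block column *)

Section LowerPart.
Context {R : realType} {p q : nat}.

Definition lower_index : {set 'I_(p + q) * 'I_p} :=
  [set ij : 'I_(p + q) * 'I_p | (ij.2 <= ij.1)%N].

(** Above the diagonal, column j has j entries, and these sum to C(p, 2). *)
Lemma card_lower_index : #|lower_index| = dim_quotO (p + q) p.
Proof.
rewrite /dim_quotO cardsCs card_prod !card_ord; congr (_ - _)%N.
rewrite -sum1_card (eq_bigl (fun ij : 'I_(p + q) * 'I_p => true && (ij.1 < ij.2)%N));
  last by move=> ij; rewrite !inE -ltnNge.
rewrite -(pair_big_dep xpredT (fun (i : 'I_(p + q)) (j : 'I_p) => i < j)%N (fun _ _ => 1%N))/=.
rewrite (exchange_big_dep xpredT)//= -bin2_sum big_mkord; apply: eq_bigr => j _.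
have jpq : (j <= p + q)%N by rewrite (leq_trans (ltnW (ltn_ord j)))// leq_addr.
by rewrite (big_ord_narrow (F := fun=> 1%N) jpq) sum1_card card_ord.
Qed.

Definition lower_pair (k : 'I_(dim_quotO (p + q) p)) : 'I_(p + q) * 'I_p :=
  enum_val (cast_ord (esym card_lower_index) k).

Lemma lower_pair_inj : injective lower_pair.
Proof. by move=> k l /enum_val_inj/cast_ord_inj. Qed.

Lemma lower_pair_le k : ((lower_pair k).2 <= (lower_pair k).1)%N.
Proof. by have := enum_valP (cast_ord (esym card_lower_index) k); rewrite inE. Qed.

Lemma lower_pair_surj (i : 'I_(p + q)) (j : 'I_p) : (j <= i)%N -> exists k, lower_pair k = (i, j).
Proof.
move=> ji; have ijL : (i, j) \in lower_index by rewrite inE.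
exists (cast_ord card_lower_index (enum_rank_in ijL (i, j))).
by rewrite /lower_pair cast_ordK enum_rankK_in.
Qed.

(** The entries on and below the diagonal determine a matrix whose top square
    block is symmetric. *)
Definition lower_part (H : 'M[R]_(p + q, p)) : 'rV[R]_(dim_quotO (p + q) p) :=
  \row_k H (lower_pair k).1 (lower_pair k).2.

Lemma lower_part_linear : linear lower_part.
Proof. by move=> a H K; apply/rowP => k; rewrite !mxE. Qed.

HB.instance Definition _ := GRing.isLinear.Build R _ _ _ lower_part lower_part_linear.

Definition top_sym (H : 'M[R]_(p + q, p)) := (usubmx H)^T = usubmx H.

Lemma lower_part_norm_le H : `|lower_part H| <= `|H|.
Proof. by apply: mx_norm_leP => // i k; rewrite mxE mx_entry_norm_le. Qed.

Lemma norm_le_lower_part H : top_sym H -> `|H| <= `|lower_part H|.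
Proof.
have low (i : 'I_(p + q)) (j : 'I_p) : (j <= i)%N -> `|H i j| <= `|lower_part H|.
  move=> /lower_pair_surj[k kij]; have := mx_entry_norm_le (lower_part H) 0 k.
  by rewrite mxE kij.
move=> /matrixP Hsym; apply: mx_norm_leP => // i j.
case: (leqP j i) => [/low//|ij].
have ip : (i < p)%N := ltn_trans ij (ltn_ord j).
have iE : i = lshift q (Ordinal ip) by apply: val_inj.
have := Hsym j (Ordinal ip); rewrite !mxE -iE => ->.
exact: (low (lshift q j) (Ordinal ip) (ltnW ij)).
Qed.

Lemma lower_part_surj w : exists2 H, top_sym H & lower_part H = w.
Proof.
(* The sum selects the coordinate attached to the pair (a, b); max and min extend
   the values symmetrically above the diagonal. *)
pose g (a b : nat) : R :=
  \sum_(k | ((lower_pair k).1 == a :> nat) && ((lower_pair k).2 == b :> nat)) w 0 k.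
exists (\matrix_(i, j) g (maxn i j) (minn i j)).
  by apply/matrixP => i j; rewrite !mxE/= maxnC minnC.
apply/rowP => k; rewrite !mxE (maxn_idPl (lower_pair_le k)) (minn_idPr (lower_pair_le k)).
rewrite /g (big_pred1 k)// => l; apply/andP/eqP => [[/eqP e1 /eqP e2]|->//].
apply: lower_pair_inj; move: e1 e2.
by case: (lower_pair l) => ? ?; case: (lower_pair k) => ? ? /= /val_inj -> /val_inj ->.
Qed.

End LowerPart.

(** * Smoothness of quadratic maps *)

Section SmoothQuadratic.
Context {R : realType}.

Lemma differentiable_eq_on (V W : normedModType R) (D : set V) (f g : V -> W) x :
  open D -> (forall x, D x -> f x = g x) -> D x -> differentiable g x ->
  differentiable f x /\ 'd f x = 'd g x :> (V -> W).
Proof.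
move=> oD fg Dx gd.
have [gcont gexp] := (diff_locallyP _ _).1 gd.
have fexp e : 0 < e -> \forall h \near (0 : V),
    `|(f \o shift x - (cst (f x) + 'd g x)) h| <= e * `|h|.
  move=> e0; move/eqaddoP : gexp => /(_ e e0) gh.
  have /nbhs_ballP[d /= d0 Dd] : nbhs x D by exact: open_nbhs_nbhs.
  near=> h.
  have Dhx : D (h + x).
    apply: Dd; rewrite -ball_normE /= opprD addrC subrK normrN.
    by near: h; apply: nbhs0_lt.
  have : `|(g \o shift x - (cst (g x) + 'd g x)) h| <= e * `|h| by near: h.
  by rewrite /= !fctE /= !fg.
have dE : 'd f x = 'd g x :> (V -> W).
  by apply: diff_unique; [exact: gcont | apply/eqaddoP].
split; last exact: dE.
by apply/diff_locallyP; rewrite dE; split; [exact: gcont | apply/eqaddoP].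
Unshelve. all: by end_near.
Qed.

Lemma Ck_on_eq k (V W : normedModType R) (D : set V) (f g : V -> W) : open D ->
  (forall x, D x -> f x = g x) -> Ck_on k D g -> Ck_on k D f.
Proof.
move=> oD; elim: k f g => [|k IHk] f g fg /=.
  move=> gc x Dx; rewrite /prop_for /continuous_at fg//.
  apply: cvg_trans (gc x Dx); apply: near_eq_cvg.
  have : nbhs x D by exact: open_nbhs_nbhs.
  by apply: filterS => y Dy; rewrite fg.
move=> [gd gCk]; have dfg x Dx := differentiable_eq_on oD fg Dx (gd x Dx).
split=> [x /dfg[]//|v]; apply: IHk (gCk v) => x /dfg[_ ->//].
Qed.

Lemma Ck_on_cst k (V W : normedModType R) (D : set V) (a : W) : Ck_on k D (cst a : V -> W).
Proof.
elim: k a => [|k IHk] a /=; first by move=> x _; exact: cst_continuous.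
split=> [x _|v]; first exact: differentiable_cst.
have -> : (fun x => 'd (cst a : V -> W) x v) = cst 0 by apply/funext => x; rewrite diff_cst.
exact: IHk.
Qed.

Lemma Ck_on_linear k (V W : normedModType R) (D : set V) (f : {linear V -> W}) :
  continuous f -> Ck_on k D f.
Proof.
move=> fc; case: k => [|k] /=; first by move=> x _; exact: fc.
split=> [x _|v]; first exact: linear_differentiable.
have -> : (fun x => 'd f x v) = cst (f v) by apply/funext => x; rewrite diff_lin.
exact: Ck_on_cst.
Qed.

Variables (V W : normedModType R) (B : V -> V -> W) (C : R).
Hypothesis C_ge0 : 0 <= C.
Hypothesis B_linl : forall Y, linear (B^~ Y).
Hypothesis B_linr : forall X, linear (B X).
Hypothesis B_bound : forall X Y, `|B X Y| <= C * `|X| * `|Y|.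

Let polar X Y := B X Y + B Y X.

Let polar_linear X : linear (polar X).
Proof. by move=> a Y Z; rewrite /polar B_linl B_linr scalerDr addrACA. Qed.

HB.instance Definition _ X := GRing.isLinear.Build R V W _ (polar X) (polar_linear X).

Let polar_continuous X : continuous (polar X).
Proof.
apply: bounded_linear_continuous; exists (C * `|X| + C * `|X|); split => [|x Cx].
  exact: num_real.
near=> Y; rewrite /= /polar (le_trans (ler_normD _ _))// (le_trans _ (ltW Cx))//.
have Y1 : `|Y| <= 1 by near: Y; apply: nbhs0_le.
have CX : 0 <= C * `|X| by exact: mulr_ge0.
apply: lerD; rewrite (le_trans (B_bound _ _))//; first by rewrite ler_piMr.
by rewrite mulrAC ler_piMr.
Unshelve. all: by end_near.
Qed.

(** B (X + h) (X + h) = B X X + polar X h + B h h, and B h h = O(|h|^2). *)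
Lemma quadratic_diff X : differentiable (fun Y => B Y Y) X /\
  'd (fun Y => B Y Y) X = polar X :> (V -> W).
Proof.
have fexp : (fun Y => B Y Y) \o shift X = cst (B X X) + polar X +o_ 0 id.
  have C1 : 0 < C + 1 by rewrite ltr_wpDl.
  apply/eqaddoP => e e0; near=> h.
  have -> : ((fun Y => B Y Y) \o shift X - (cst (B X X) + polar X)) h = B h h.
    rewrite /= !fctE /= /polar -[h + X]scale1r scalerDr !scale1r.
    have addl Y Z T : B (Y + Z) T = B Y T + B Z T by have := B_linl T 1 Y Z; rewrite !scale1r.
    have addr Y Z T : B T (Y + Z) = B T Y + B T Z by have := B_linr T 1 Y Z; rewrite !scale1r.
    rewrite addl !addr; move: (B h h) (B h X) (B X h) (B X X) => a b c d.
    have -> : a + b + (c + d) = a + (d + (c + b)); last by rewrite addrK.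
    by rewrite -addrA; congr (_ + _); rewrite addrA addrC [b + c]addrC.
  have he : C * `|h| <= e.
    rewrite (le_trans (y := `|h| * (C + 1)))//.
      by rewrite mulrDr mulr1 mulrC lerDl.
    by rewrite -ler_pdivlMr//; near: h; apply: nbhs0_le; exact: divr_gt0.
  by rewrite (le_trans (B_bound _ _))// ler_wpM2r.
have dE := diff_unique (@polar_continuous X) fexp; split=> //.
by apply/diff_locallyP; rewrite dE; split=> //; exact: polar_continuous.
Unshelve. all: by end_near.
Qed.

Lemma smooth_on_quadratic (D : set V) : smooth_on D (fun X => B X X).
Proof.
case=> [x _|k /=]; first by apply: differentiable_continuous; have [] := quadratic_diff x.
split=> [x _|v]; first by have [] := quadratic_diff x.
have -> : (fun x => 'd (fun X => B X X) x v) = polar v.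
  by apply/funext => x; have [_ ->] := quadratic_diff x; rewrite /polar addrC.
exact/Ck_on_linear/polar_continuous.
Qed.

Lemma smooth_on_eq (D : set V) (f g : V -> W) : open D ->
  (forall x, D x -> f x = g x) -> smooth_on D g -> smooth_on D f.
Proof. by move=> oD fg gs k; exact: (Ck_on_eq oD fg). Qed.

End SmoothQuadratic.

(** * Coordinates on the quotient *)

Section OrbitInvariant.
Context {R : realType} {p q : nat}.
Variables (V : 'M[R]_(p + q, p)) (C : 'M[R]_(p + q, q)).
Hypotheses (VV : V^T *m V = 1%:M) (CC : C^T *m C = 1%:M) (VC : V^T *m C = 0).
Implicit Types X Y : 'M[R]_(p + q, p).

Let W : 'M[R]_(p + q) := row_mx V C.

Let CV : C^T *m V = 0.
Proof. by apply: trmx_inj; rewrite trmx_mul trmxK VC trmx0. Qed.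

Let WW : W^T *m W = 1%:M.
Proof. by rewrite tr_row_mx mul_col_row VV CC CV VC -scalar_mx_block. Qed.

Lemma frame_decomposition X : X = V *m (V^T *m X) + C *m (C^T *m X).
Proof.
by rewrite !mulmxA -mulmxDl -mul_row_col -tr_row_mx (mulmx1C WW) mul1mx.
Qed.

(** Up to the change of frame W = [V C] this is the first block column of
    X X^T, which determines the class of X modulo O_p when V^T X is
    invertible. *)
Definition orbit_inv X : 'M[R]_(p + q, p) := W^T *m X *m X^T *m V.

Lemma orbit_invE X : orbit_inv X =
  col_mx (V^T *m X *m (V^T *m X)^T) (C^T *m X *m (V^T *m X)^T).
Proof. by rewrite /orbit_inv tr_row_mx !mul_col_mx trmx_mul trmxK !mulmxA. Qed.

Lemma orbit_inv_base : orbit_inv V = col_mx 1%:M 0.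
Proof. by rewrite orbit_invE VV CV trmx1 mulmx1 mul0mx. Qed.

Lemma orbit_inv_mulQ X (Q : 'M[R]_p) : Q^T *m Q = 1%:M ->
  orbit_inv (X *m Q) = orbit_inv X.
Proof.
move=> /mulmx1C QQ; rewrite /orbit_inv trmx_mul !mulmxA.
by rewrite -(mulmxA _ Q Q^T) QQ mulmx1.
Qed.

Lemma orbit_inv_top_sym X : top_sym (orbit_inv X).
Proof. by rewrite /top_sym orbit_invE col_mxKu trmx_mul trmxK. Qed.

Lemma orbit_inv_sub_top_sym X Y : top_sym (orbit_inv X - orbit_inv Y).
Proof. by rewrite /top_sym !linearB/= !orbit_inv_top_sym. Qed.

Definition orbit_dist X : R := `|orbit_inv X - orbit_inv V|.

Lemma orbit_dist_mulQ X (Q : 'M[R]_p) : Q^T *m Q = 1%:M ->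
  orbit_dist (X *m Q) = orbit_dist X.
Proof. by move=> QQ; rewrite /orbit_dist orbit_inv_mulQ. Qed.

Lemma orbit_dist_base : orbit_dist V = 0.
Proof. by rewrite /orbit_dist subrr normr0. Qed.

Lemma orbit_dist_le : exists2 c, 0 <= c & forall X, `|X - V| <= 1 ->
  orbit_dist X <= c * `|X - V|.
Proof.
pose N : R := (p + q)%:R.
exists (N * N * (3 * p%:R)); first by rewrite !mulr_ge0.
move=> X; set D := X - V => D1; have XE : X = V + D by rewrite addrC subrK.
have V1 := orthonormal_norm_le1 VV.
have -> : orbit_dist X = `|W^T *m (V *m D^T + D *m V^T + D *m D^T) *m V|.
  rewrite /orbit_dist /orbit_inv XE; congr `|_|.
  rewrite [(V + D)^T]linearD/= !(mulmxDl, mulmxDr) !mulmxA; mxlin.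
rewrite (le_trans (mul_orthonormal_norm_le _ VV))// -!mulrA ler_wpM2l//.
have WT1 : `|W^T| <= 1 by rewrite trmx_norm orthonormal_norm_le1.
rewrite (le_trans (mulmx_norm_le _ _))// -mulrA ler_wpM2l// -[leRHS]mul1r ler_pM//.
have mul_le (P P' : 'M[R]_(p + q, p)) : `|P *m P'^T| <= p%:R * (`|P| * `|P'|).
  by rewrite mulrA (le_trans (mulmx_norm_le _ _))// trmx_norm.
have le1 : `|V *m D^T| <= p%:R * `|D|.
  by rewrite (le_trans (mul_le _ _))// ler_wpM2l// ler_piMl.
have le2 : `|D *m V^T| <= p%:R * `|D|.
  by rewrite (le_trans (mul_le _ _))// ler_wpM2l// ler_piMr.
have le3 : `|D *m D^T| <= p%:R * `|D|.
  by rewrite (le_trans (mul_le _ _))// ler_wpM2l// ler_piMr.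
have := ler_normD (V *m D^T + D *m V^T) (D *m D^T).
have := ler_normD (V *m D^T) (D *m V^T).
move: le1 le2 le3; move: `|V *m D^T| `|D *m V^T| `|D *m D^T| => x y z.
move: `|_ + _| `|_ + _| (p%:R * `|D|) => s t u; lra.
Qed.

(** The symmetric representative X Q comes from the polar decomposition
    V^T X = T Q^T, where T is the square root of V^T X X^T V near the identity.
    Then V^T X Q - 1 = T - 1, and C^T X Q is recovered from the bottom block of
    [orbit_inv X] by dividing by T. *)
Lemma symmetric_representative X : p%:R * orbit_dist X <= 2^-1 ->
  exists2 Q : 'M[R]_p, Q^T *m Q = 1%:M &
    [/\ (V^T *m (X *m Q))^T = V^T *m (X *m Q),
        V^T *m (X *m Q) \in unitmx &
        `|X *m Q - V| <= (p%:R + 2 * q%:R) * orbit_dist X].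
Proof.
move=> small; pose P := V^T *m X *m (V^T *m X)^T.
pose K := C^T *m X *m (V^T *m X)^T.
have distE : orbit_dist X = `|col_mx (P - 1%:M) K|.
  by rewrite /orbit_dist orbit_inv_base orbit_invE opp_col_mx add_col_mx subr0.
have Ele : `|P - 1%:M| <= orbit_dist X.
  rewrite distE; apply: mx_norm_leP => // i j.
  by rewrite -(col_mxEu _ K) mx_entry_norm_le.
have Kle : `|K| <= orbit_dist X.
  rewrite distE; apply: mx_norm_leP => // i j.
  by rewrite -(col_mxEd (P - 1%:M)) mx_entry_norm_le.
have [||D [Dsym DE sqE]] := @sqrt_near1 R p (P - 1%:M).
- by rewrite linearB/= trmx1 trmx_mul trmxK.
- by rewrite (le_trans _ small)// ler_wpM2l.
have Dsmall : p%:R * `|D| <= 2^-1.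
  by rewrite (le_trans _ small)// ler_wpM2l// (le_trans DE).
pose T := 1%:M + D; have Tsym : T^T = T by rewrite linearD/= trmx1 Dsym.
have Tu : T \in unitmx.
  by apply: near1_unitmx; rewrite /T opprD addrA subrr add0r normrN.
have TT : T *m T = P by rewrite sqE addrC subrK.
have Tinv_sym : (invmx T)^T = invmx T by rewrite trmx_inv Tsym.
pose Q := (V^T *m X)^T *m invmx T.
have VXQ : V^T *m (X *m Q) = T by rewrite /Q !mulmxA -/P -TT mulmxK.
exists Q.
  rewrite /Q trmx_mul trmxK Tinv_sym mulmxA -(mulmxA _ _ (_^T)) -/P -TT.
  by rewrite mulKmx// mulmxV.
split; rewrite ?VXQ//.
pose L := C^T *m (X *m Q).
have LE : L = K - L *m D.
  have : L *m T = K by rewrite /L /Q !mulmxA mulmxKV.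
  by rewrite mulmxDr mulmx1 => <-; rewrite addrK.
have Lle : `|L| <= 2 * orbit_dist X.
  have := ler_normB K (L *m D); rewrite -LE.
  have : `|L *m D| <= 2^-1 * `|L|.
    by rewrite (le_trans (mulmx_norm_le _ _))// mulrAC ler_wpM2r.
  move: Kle; move: `|L| `|K| `|_ *m _| (orbit_dist X) => x y z t; lra.
have -> : X *m Q - V = V *m D + C *m L.
  rewrite [X *m Q]frame_decomposition VXQ -/L mulmxDr mulmx1; mxlin.
have V1 := orthonormal_norm_le1 VV; have C1 := orthonormal_norm_le1 CC.
rewrite (le_trans (ler_normD _ _))// mulrDl lerD//.
  rewrite (le_trans (mulmx_norm_le _ _))// -mulrA ler_wpM2l//.
  by rewrite -[leRHS]mul1r ler_pM// (le_trans DE).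
rewrite (le_trans (mulmx_norm_le _ _))// [2 * _]mulrC -!mulrA ler_wpM2l//.
by rewrite -[leRHS]mul1r ler_pM.
Qed.

Lemma near_fullrank X : p%:R * orbit_dist X <= 2^-1 ->
  X^T *m X \in unitmx /\ V^T *m X \in unitmx.
Proof.
move=> /symmetric_representative[Q QQ [_ VXQu _]].
have Qu : Q \in unitmx by case: (mulmx1_unit QQ).
have VXu : V^T *m X \in unitmx by move: VXQu; rewrite mulmxA unitmx_mul Qu andbT.
by split=> //; apply: (@gram_unit _ _ _ _ (invmx (V^T *m X) *m V^T)); rewrite -mulmxA mulVmx.
Qed.

Lemma orbit_inv_inj X Y : V^T *m Y \in unitmx -> orbit_inv X = orbit_inv Y ->
  exists2 Q : 'M[R]_p, Q^T *m Q = 1%:M & Y = X *m Q.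
Proof.
rewrite !orbit_invE => Yu /eq_col_mx[eqV eqC].
have YTu : (V^T *m Y)^T \in unitmx by rewrite unitmx_tr.
pose Q := (V^T *m X)^T *m invmx (V^T *m Y)^T.
have VXQ : V^T *m X *m Q = V^T *m Y by rewrite mulmxA eqV mulmxK.
have CXQ : C^T *m X *m Q = C^T *m Y by rewrite mulmxA eqC mulmxK.
exists Q.
  rewrite /Q trmx_mul trmxK trmx_inv trmxK mulmxA -(mulmxA _ _ (_^T)) eqV.
  by rewrite mulKmx// mulmxV.
by rewrite [LHS]frame_decomposition [RHS]frame_decomposition !(mulmxA _^T X Q) VXQ CXQ.
Qed.

(** The symmetric square root of the top block is taken as V^T X. *)
Lemma orbit_inv_surj (H : 'M[R]_(p + q, p)) : top_sym H ->
  p%:R * `|H - orbit_inv V| <= 2^-1 -> exists X, orbit_inv X = H.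
Proof.
rewrite -[H]vsubmxK /top_sym col_mxKu => Hsym.
rewrite orbit_inv_base opp_col_mx add_col_mx subr0 => small.
set P := usubmx H in Hsym small *; set K := dsubmx H in small *.
have Ele : `|P - 1%:M| <= `|col_mx (P - 1%:M) K|.
  by apply: mx_norm_leP => // i j; rewrite -(col_mxEu _ K) mx_entry_norm_le.
have [||D [Dsym DE sqE]] := @sqrt_near1 R p (P - 1%:M).
- by rewrite linearB/= trmx1 Hsym.
- by rewrite (le_trans _ small)// ler_wpM2l.
have Tu : 1%:M + D \in unitmx.
  apply: near1_unitmx; rewrite opprD addrA subrr add0r normrN.
  by rewrite (le_trans _ small)// ler_wpM2l// (le_trans DE).
have Tsym : (1%:M + D)^T = 1%:M + D by rewrite linearD/= trmx1 Dsym.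
move: (1%:M + D) Tu Tsym sqE => T Tu Tsym TT.
exists (V *m T + C *m (K *m invmx T)).
rewrite orbit_invE !mulmxDr !(mulmxA V^T) !(mulmxA C^T) VV VC CC CV.
by rewrite !mul0mx !mul1mx addr0 add0r Tsym TT mulmxKV// [1%:M + _]addrC subrK.
Qed.

(** The left-hand side is the derivative of [orbit_inv] at X in the direction Y.
    If P is the top block of H, V^T Y = P (V^T X)^-T / 2 accounts for P, and then
    the bottom block of H determines C^T Y. *)
Lemma orbit_inv_submersive X (H : 'M[R]_(p + q, p)) : V^T *m X \in unitmx ->
  top_sym H -> exists Y, W^T *m X *m Y^T *m V + W^T *m Y *m X^T *m V = H.
Proof.
rewrite -[H]vsubmxK /top_sym col_mxKu; set P := usubmx H; set K := dsubmx H.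
move=> Xu Psym; have XTu : (V^T *m X)^T \in unitmx by rewrite unitmx_tr.
pose Y1 := 2^-1 *: (P *m invmx (V^T *m X)^T).
pose Y2 := (K - C^T *m X *m Y1^T) *m invmx (V^T *m X)^T.
exists (V *m Y1 + C *m Y2).
have VY : V^T *m (V *m Y1 + C *m Y2) = Y1.
  by rewrite mulmxDr !(mulmxA V^T) VV VC mul1mx mul0mx addr0.
have CY : C^T *m (V *m Y1 + C *m Y2) = Y2.
  by rewrite mulmxDr !(mulmxA C^T) CV CC mul1mx mul0mx add0r.
move: (V *m Y1 + C *m Y2) VY CY => Y VY CY.
have YV : Y^T *m V = Y1^T by rewrite -VY trmx_mul trmxK.
have XV : X^T *m V = (V^T *m X)^T by rewrite trmx_mul trmxK.
have PE : Y1 *m (V^T *m X)^T = 2^-1 *: P by rewrite /Y1 -scalemxAl mulmxKV.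
rewrite tr_row_mx !mul_col_mx -!(mulmxA _ _ V) YV XV VY CY add_col_mx.
congr col_mx; last by rewrite /Y2 mulmxKV//; mxlin.
have -> : V^T *m X *m Y1^T = 2^-1 *: P.
  by apply: trmx_inj; rewrite trmx_mul trmxK PE linearZ/= Psym.
by rewrite PE; mxlin.
Qed.

End OrbitInvariant.

(** * The Newton step on classes *)

Lemma Mstar_ex {R : realType} n p (X : 'M[R]_(n, p)) :
  fullrank R n p X -> exists Y : Mstar R n p, \val Y = X.
Proof. by move=> Xf; exists (exist _ X (mem_set Xf)). Qed.

Section NewtonOnClasses.
Context {R : realType} {p q : nat}.
Variables (A : 'M[R]_(p + q)) (V : 'M[R]_(p + q, p)) (C : 'M[R]_(p + q, q)).
Variable M : 'M[R]_p.
Hypotheses (VV : V^T *m V = 1%:M) (CC : C^T *m C = 1%:M) (VC : V^T *m C = 0).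
Hypothesis A_sym : A^T = A.
Hypothesis AV : A *m V = V *m M.
Hypothesis M_posdef : forall x : 'cV[R]_p, x != 0 -> 0 < (x^T *m M *m x) 0 0.
Hypothesis normal_inj :
  forall Z : 'M[R]_(p + q, p), V^T *m Z = 0 -> A *m Z = Z *m M -> Z = 0.

Lemma newton_solution_mulQ (X Z : 'M[R]_(p + q, p)) (Q : 'M[R]_p) :
  Q^T *m Q = 1%:M -> X^T *m X \in unitmx ->
  newton_solution A (X *m Q) (Z *m Q) <-> newton_solution A X Z.
Proof.
move=> QQ Xu; have XQu : (X *m Q)^T *m (X *m Q) \in unitmx by rewrite gram_mulQ_unit.
have pn : (p <= p + q)%N by exact: leq_addr.
rewrite !newton_opP// newton_op_mulQ// oja_lift_mulQ// -mulNmx; split=> [|->//].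
have Qu : Q \in unitmx by case: (mulmx1_unit QQ).
exact: (can_inj (mulmxK Qu)).
Qed.

Lemma unique_newton_solution_mulQ (X Z : 'M[R]_(p + q, p)) (Q : 'M[R]_p) :
  Q^T *m Q = 1%:M -> X^T *m X \in unitmx ->
  unique (newton_solution A (X *m Q)) Z ->
  unique (newton_solution A X) (Z *m Q^T).
Proof.
move=> QQ Xu [solZ uniZ]; have QQ' := mulmx1C QQ; split.
  by apply/(newton_solution_mulQ _ QQ Xu); rewrite -mulmxA QQ mulmx1.
move=> Y /(newton_solution_mulQ _ QQ Xu)/uniZ ->.
by rewrite -mulmxA QQ' mulmx1.
Qed.

(** One step squares the distance between classes: by equivariance it may be
    computed at the symmetric representative, to which the local estimate at V
    applies. *)
Lemma newton_contracts : exists eps kappa : R,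
  [/\ 0 < eps, 0 <= kappa, p%:R * eps <= 2^-1 &
  forall X : 'M[R]_(p + q, p), orbit_dist V C X < eps ->
    X^T *m X \in unitmx /\ exists2 Z, unique (newton_solution A X) Z &
      orbit_dist V C (X + Z) <= kappa * orbit_dist V C X ^+ 2 /\
      orbit_dist V C (X + Z) <= 2^-1 * orbit_dist V C X].
Proof.
have [c2 c2_ge0 dist_le] := orbit_dist_le VV CC VC.
have [r [K [r_gt0 K_ge0 local]]] :=
  newton_local VV A_sym AV M_posdef normal_inj (leq_addr q p).
pose c1 : R := p%:R + 2 * q%:R; have c1_ge0 : 0 <= c1 by rewrite addr_ge0// mulr_ge0.
pose K1 := K * c1 ^+ 2; have K1_ge0 : 0 <= K1 by rewrite mulr_ge0// exprn_ge0.
pose kappa := c2 * K1; have kappa_ge0 : 0 <= kappa by exact: mulr_ge0.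
have c1r_ge0 : 0 <= c1 / r by rewrite divr_ge0// ltW.
(* With eps = 1/N the symmetric representative exists (2 p) in the region of the
   local estimate (c1 / r), its successor stays at distance at most 1 from V (K1),
   and the distance to the class of V is halved (2 kappa). *)
pose N : R := 1 + 2 * p%:R + c1 / r + K1 + 2 * kappa.
have N_ge1 : 1 <= N.
  rewrite /N -!addrA lerDl !addr_ge0// ?mulr_ge0//.
have N_gt0 : 0 < N := lt_le_trans ltr01 N_ge1.
pose eps := N^-1; have eps_gt0 : 0 < eps by rewrite invr_gt0.
have epsN : eps * N = 1 by rewrite mulVf// gt_eqF.
have [e1 e2 e3 e4 e5] : [/\ eps <= 1, 2 * (p%:R * eps) <= 1, c1 / r * eps <= 1,
    K1 * eps <= 1 & 2 * kappa * eps <= 1].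
  have x1 : 0 <= p%:R * eps by rewrite mulr_ge0// ltW.
  have x2 : 0 <= c1 / r * eps by rewrite mulr_ge0// ltW.
  have x3 : 0 <= K1 * eps by rewrite mulr_ge0// ltW.
  have x4 : 0 <= kappa * eps by rewrite mulr_ge0// ltW.
  by move: epsN; rewrite /N => epsN; split; lra.
exists eps, kappa; split => //; first lra.
move=> X; set e := orbit_dist V C X => e_lt.
have e_ge0 : 0 <= e by exact: normr_ge0.
have small : p%:R * e <= 2^-1.
  have := ler_wpM2l (ler0n R p) (ltW e_lt); lra.
have [Xu _] := near_fullrank VV CC VC small; split => //.
have [Q QQ [XQsym _ XQ_le]] := symmetric_representative VV CC VC small.
have XQ_r : `|X *m Q - V| <= r.
  have c1eps : c1 * eps <= r by move: e3; rewrite mulrAC ler_pdivrMr// mul1r.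
  by rewrite (le_trans XQ_le)// (le_trans _ c1eps)// ler_wpM2l// ltW.
have [_ [Z uniZ] quad] := local _ XQ_r.
have {quad} Znear : `|X *m Q + Z - V| <= K1 * e ^+ 2.
  rewrite (le_trans (quad XQsym _ uniZ.1))// /K1 -mulrA ler_wpM2l// -exprMn.
  by rewrite ler_pXn2r// nnegrE// mulr_ge0.
exists (Z *m Q^T); first exact: unique_newton_solution_mulQ.
have -> : orbit_dist V C (X + Z *m Q^T) = orbit_dist V C (X *m Q + Z).
  by rewrite -(orbit_dist_mulQ V C _ QQ) mulmxDl -mulmxA QQ mulmx1.
have e_le := ltW e_lt.
have Z1 : `|X *m Q + Z - V| <= 1.
  rewrite (le_trans Znear)// expr2 mulrA (le_trans _ e4)// -mulrA ler_wpM2l//.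
  by rewrite (le_trans _ e_le)// ler_piMr// (le_trans e_le).
have step : orbit_dist V C (X *m Q + Z) <= kappa * e ^+ 2.
  by rewrite (le_trans (dist_le _ Z1))// /kappa -mulrA ler_wpM2l.
split=> //; rewrite (le_trans step)// expr2 mulrA ler_wpM2r//.
have := ler_wpM2l kappa_ge0 e_le; lra.
Qed.

End NewtonOnClasses.

(** * The chart *)

Section Chart.
Context {R : realType} {p q : nat}.
Variables (V : 'M[R]_(p + q, p)) (C : 'M[R]_(p + q, q)).
Hypotheses (VV : V^T *m V = 1%:M) (CC : C^T *m C = 1%:M) (VC : V^T *m C = 0).
Variable eps : R.
Hypotheses (eps_gt0 : 0 < eps) (eps_small : p%:R * eps <= 2^-1).
Implicit Types X Y : 'M[R]_(p + q, p).

Let W : 'M[R]_(p + q) := row_mx V C.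

Let WW : W^T *m W = 1%:M.
Proof.
have CV : C^T *m V = 0 by apply: trmx_inj; rewrite trmx_mul trmxK VC trmx0.
by rewrite tr_row_mx mul_col_row VV CC CV VC -scalar_mx_block.
Qed.

Definition coordinates X := lower_part (orbit_inv V C X).

Lemma coordinates_distE X Y :
  `|coordinates X - coordinates Y| = `|orbit_inv V C X - orbit_inv V C Y|.
Proof.
rewrite /coordinates -linearB/=; apply/le_anti.
by rewrite lower_part_norm_le norm_le_lower_part//; exact: orbit_inv_sub_top_sym.
Qed.

(** The polarization of the quadratic map [coordinates]. *)
Definition coordinates2 X Y := lower_part (W^T *m X *m Y^T *m V).

Lemma coordinates2_linl Y : linear (coordinates2^~ Y).
Proof.
move=> a X Z; rewrite /coordinates2 -linearP; congr lower_part.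
by rewrite mulmxDr !mulmxDl -scalemxAr -!scalemxAl.
Qed.

Lemma coordinates2_linr X : linear (coordinates2 X).
Proof.
move=> a Y Z; rewrite /coordinates2 -linearP; congr lower_part.
by rewrite linearP/= mulmxDr mulmxDl -scalemxAr -scalemxAl.
Qed.

Lemma coordinates2_bound X Y :
  `|coordinates2 X Y| <= (p + q)%:R * ((p + q)%:R * p%:R) * `|X| * `|Y|.
Proof.
rewrite (le_trans (lower_part_norm_le _))// (le_trans (mul_orthonormal_norm_le _ VV))//.
rewrite -!mulrA ler_wpM2l// -(mulmxA _ X) (le_trans (mulmx_norm_le _ _))// -!mulrA.
rewrite ler_wpM2l// trmx_norm (le_trans (y := `|X *m Y^T|))//.
  by rewrite ler_piMl// orthonormal_norm_le1.
by rewrite mulrA (le_trans (mulmx_norm_le _ _))// trmx_norm.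
Qed.

Let bound_ge0 : 0 <= (p + q)%:R * ((p + q)%:R * p%:R) :> R.
Proof. by rewrite !mulr_ge0. Qed.

Lemma coordinates_diff X : differentiable coordinates X /\
  'd coordinates X = (fun Y => coordinates2 X Y + coordinates2 Y X)
    :> (_ -> _).
Proof.
exact: (quadratic_diff bound_ge0 coordinates2_linl coordinates2_linr coordinates2_bound).
Qed.

Lemma coordinates_smooth (D : set 'M[R]_(p + q, p)) : smooth_on D coordinates.
Proof.
exact: (smooth_on_quadratic bound_ge0 coordinates2_linl coordinates2_linr coordinates2_bound).
Qed.

Definition orbit_ball : set 'M[R]_(p + q, p) := [set X | orbit_dist V C X < eps].

Lemma orbit_ball_open : open orbit_ball.
Proof.
have -> : orbit_ball = (fun X => `|coordinates X - coordinates V|) @^-1` [set x | x < eps].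
  by apply/seteqP; split=> X; rewrite /orbit_ball/= coordinates_distE.
apply: open_comp; last exact: open_lt.
move=> X _; apply: continuous_comp; last exact: norm_continuous.
apply: continuousB; last exact: cst_continuous.
by apply: differentiable_continuous; have [] := coordinates_diff X.
Qed.

Let ball_small X : orbit_ball X -> p%:R * orbit_dist V C X <= 2^-1.
Proof.
by move=> /ltW Xe; rewrite (le_trans _ eps_small)// ler_wpM2l.
Qed.

Lemma orbit_ball_fullrank : orbit_ball `<=` fullrank R (p + q) p.
Proof. by move=> X /ball_small/(near_fullrank VV CC VC)[/fullrankE]. Qed.

Definition chart_fun (x : quotO R (p + q) p) : 'rV[R]_(dim_quotO (p + q) p) :=
  coordinates (\val (repr x)).

Lemma chart_fun_class (X : Mstar R (p + q) p) :
  chart_fun (classO X) = coordinates (\val X).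
Proof.
have : classO (repr (classO X)) = classO X by exact: reprK.
move=> /classO_eqP[Q QQ XE]; rewrite /chart_fun /coordinates XE.
by rewrite orbit_inv_mulQ.
Qed.

Definition chart_dom : set (quotO R (p + q) p) :=
  [set x | `|chart_fun x - coordinates V| < eps].

Lemma chart_dom_class (X : Mstar R (p + q) p) :
  chart_dom (classO X) <-> orbit_ball (\val X).
Proof. by rewrite /chart_dom/= chart_fun_class coordinates_distE. Qed.

Lemma classO_surj (x : quotO R (p + q) p) : exists X : Mstar R (p + q) p, x = classO X.
Proof. by exists (repr x); rewrite /classO reprK. Qed.

Lemma chart_dom_preimage : [set \val X | X in @classO R (p + q) p @^-1` chart_dom] = orbit_ball.
Proof.
apply/seteqP; split=> [_ [X XD <-]|X XB]; first exact/chart_dom_class.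
have Xf := orbit_ball_fullrank XB.
by exists (exist _ X (mem_set Xf)) => //; apply/chart_dom_class.
Qed.

Lemma class_lift_chart X : orbit_ball X -> class_lift chart_fun X = coordinates X.
Proof.
move=> XB; rewrite /class_lift; case: insubP => [Y _ <-|]; first exact: chart_fun_class.
by move/negP; case; exact/mem_set/orbit_ball_fullrank.
Qed.

(** Injectivity and the image follow from [orbit_inv_inj] and [orbit_inv_surj];
    the image is a ball because top symmetric matrices are determined by, and
    have the norm of, their lower part. *)
Lemma quot_chart_invariant : quot_chart chart_dom chart_fun.
Proof.
split.
- rewrite /open/= /quotient_open.
  exists orbit_ball; first exact: orbit_ball_open.
  by apply/seteqP; split=> X; move=> /chart_dom_class.
- move=> x y; have [[X ->] [Y ->]] := (classO_surj x, classO_surj y).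
  move=> _ /set_mem/chart_dom_class/ball_small/(near_fullrank VV CC VC)[_ Yu].
  rewrite !chart_fun_class => /eqP; rewrite -subr_eq0 -normr_eq0 coordinates_distE.
  rewrite normr_eq0 subr_eq0 => /eqP/(orbit_inv_inj VV CC VC Yu)[Q QQ YE].
  by apply/classO_eqP; exists Q.
- suff -> : chart_fun @` chart_dom = ball (coordinates V) eps by exact: ball_open.
  rewrite -ball_normE; apply/seteqP; split=> [_ [x xD <-]|w /=]; first by rewrite /= distrC.
  rewrite distrC; have [H Hsym <-] := lower_part_surj w => w_near.
  have Hsmall : p%:R * `|H - orbit_inv V C V| <= 2^-1.
    rewrite (le_trans _ eps_small)// ler_wpM2l// (le_trans _ (ltW w_near))//.
    rewrite /coordinates -linearB/= norm_le_lower_part//.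
    by rewrite /top_sym !linearB/= orbit_inv_top_sym Hsym.
  have [X XH] := orbit_inv_surj VV CC VC Hsym Hsmall.
  have XB : orbit_ball X.
    by rewrite /orbit_ball/= /orbit_dist -coordinates_distE /coordinates XH.
  exists (classO (exist _ X (mem_set (orbit_ball_fullrank XB)) : Mstar R (p + q) p)).
    exact/chart_dom_class.
  by rewrite chart_fun_class /= /coordinates XH.
- rewrite chart_dom_preimage; split.
    apply: (smooth_on_eq orbit_ball_open class_lift_chart).
    exact: coordinates_smooth.
  move=> X XB w; have [H Hsym Hw] := lower_part_surj w.
  have [_ VXu] := near_fullrank VV CC VC (ball_small XB).
  have [Y YH] := orbit_inv_submersive VV CC VC VXu Hsym.
  have [Xd dX] := coordinates_diff X; exists Y.
  have [_ ->] := differentiable_eq_on orbit_ball_open class_lift_chart XB Xd.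
  by rewrite dX /coordinates2 -linearD/= YH.
Qed.

(** An open set of classes containing the class of V pulls back to a
    neighbourhood of V, which eventually contains the symmetric representatives. *)
Lemma orbit_dist_cvg (Vs : Mstar R (p + q) p) (x : nat -> Mstar R (p + q) p) :
  \val Vs = V -> (forall e, 0 < e -> \forall k \near \oo, orbit_dist V C (\val (x k)) < e) ->
  classO (x k) @[k --> \oo] --> classO Vs.
Proof.
move=> VsE x_near B; rewrite nbhsE => -[D [oD Ds] DB].
have [G openG GD] : exists2 G, open G & \val @^-1` G = @classO R (p + q) p @^-1` D.
  by case: oD => G openG GD; exists G.
have GV : G V by rewrite -VsE; have : (\val @^-1` G) Vs by rewrite GD.
have /nbhs_ballP[d /= d0 dG] : nbhs V G by apply: open_nbhs_nbhs.
pose c : R := p%:R + 2 * q%:R + 1.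
have c_gt0 : 0 < c by rewrite ltr_wpDl// addr_ge0// mulr_ge0.
have dist_small : 0 < Num.min eps (d / c) by rewrite lt_min eps_gt0 divr_gt0.
apply: filterS (x_near _ dist_small) => k /=; rewrite lt_min => /andP[x_eps x_d].
apply: DB; have small := ball_small x_eps.
have [Q QQ [_ _ XQ]] := symmetric_representative VV CC VC small.
have XQd : ball V d (\val (x k) *m Q).
  rewrite -ball_normE /= distrC (le_lt_trans XQ)//.
  move: x_d; rewrite ltr_pdivlMr//; apply: le_lt_trans.
  by rewrite mulrC ler_wpM2l ?normr_ge0// /c lerDl.
have XQf : fullrank R (p + q) p (\val (x k) *m Q).
  apply/fullrankE; rewrite gram_mulQ_unit//.
  by have [] := near_fullrank VV CC VC small.
have [Y YE] := Mstar_ex XQf.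
have -> : classO (x k) = classO Y by apply/classO_eqP; exists Q.
have : (\val @^-1` G) Y by rewrite /= YE; exact: dG.
by rewrite GD.
Qed.

End Chart.

(** * Convergence *)

Lemma orthonormal_basesP {R : realType} n p (E : {vspace 'cV[R]_n})
    (V X : 'M[R]_(n, p)) : orthonormal_bases p E V ->
  orthonormal_bases p E X <-> exists2 Q : 'M[R]_p, Q^T *m Q = 1%:M & X = V *m Q.
Proof.
move=> [Vspan VV]; split=> [[Xspan XX]|[Q QQ ->]].
  have [Q QE] : exists Q : 'M[R]_p, X = V *m Q.
    have Xcol j : exists c : 'cV[R]_p, col j X = V *m c.
      apply/in_span_cols; rewrite Vspan -Xspan; apply/in_span_cols.
      by exists (delta_mx j 0); rewrite -colE.
    have [c cE] := choice Xcol; exists (\matrix_(i, j) c j i 0).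
    apply/matrixP => i j; have /colP/(_ i) := cE j; rewrite !mxE => ->.
    by apply: eq_bigr => k _; rewrite mxE.
  exists Q => //; rewrite -XX QE trmx_mul mulmxA -(mulmxA _ V^T V) VV mulmx1//.
split; last by rewrite trmx_mul mulmxA -(mulmxA _ V^T V) VV mulmx1.
rewrite -Vspan; apply/vspaceP => v; apply/idP/idP => /in_span_cols[c ->]; apply/in_span_cols.
  by exists (Q *m c); rewrite mulmxA.
by exists (Q^T *m c); rewrite mulmxA -(mulmxA V) (mulmx1C QQ) mulmx1.
Qed.

(** The columns of A V lie in E, on which V V^T is the identity. *)
Lemma invariant_compression {R : realType} n p (A : 'M[R]_n) (E : {vspace 'cV[R]_n})
    (V : 'M[R]_(n, p)) : (forall x, x \in E -> A *m x \in E) ->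
  orthonormal_bases p E V -> A *m V = V *m (V^T *m A *m V).
Proof.
move=> E_inv [Vspan VV]; set M := V^T *m A *m V.
have AVcol j : col j (A *m V) = V *m V^T *m col j (A *m V).
  have : col j (A *m V) \in E.
    rewrite colE -mulmxA -colE; apply: E_inv; rewrite -Vspan; apply/in_span_cols.
    by exists (delta_mx j 0); rewrite -colE.
  rewrite -Vspan => /in_span_cols[c ->].
  by rewrite -!mulmxA (mulmxA V^T) VV mul1mx.
apply/matrixP => i j.
have /colP/(_ i) : col j (A *m V) = col j (V *m M).
  by rewrite AVcol /M !colE !mulmxA.
by rewrite [LHS]mxE [RHS]mxE.
Qed.

Lemma geometric_decay {R : realType} (u : nat -> R) : 0 <= u 0%N ->
  (forall k, u k.+1 <= 2^-1 * u k) ->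
  forall e, 0 < e -> \forall k \near \oo, u k < e.
Proof.
move=> u0 u_half e e0.
have u_le k : u k <= u 0%N * 2^-1 ^+ k.
  elim: k => [|k IHk]; first by rewrite expr0 mulr1.
  rewrite (le_trans (u_half k))// exprS mulrCA ler_wpM2l//.
have : u 0%N * 2^-1 ^+ k @[k --> \oo] --> (0 : R).
  rewrite -[X in _ --> X](mulr0 (u 0%N)); apply: cvgMr; apply: cvg_expr.
  by rewrite gtr0_norm ?invr_gt0// invf_lt1// ltr1n.
move=> /cvgrPdist_lt/(_ e e0); apply: filterS => k; rewrite sub0r normrN => uk.
by rewrite (le_lt_trans (u_le k))// (le_lt_trans (ler_norm _)).
Qed.

Theorem mainTheorem3 (R : realType) (n p : nat) (p_gt0 : (0 < p)%N)
    (p_lt_n : (p < n)%N) (A : 'M[R]_n) (A_sym : A^T = A)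
    (A_posdef : forall x : 'cV[R]_n, x != 0 -> 0 < (x^T *m A *m x) 0 0)
    (lambda : 'I_n -> R)
    (lambda_decr : forall i j : 'I_n, (i < j)%N -> lambda j < lambda i)
    (A_eigen : char_poly A = \prod_(i < n) ('X - (lambda i)%:P))
    (E : {vspace 'cV[R]_n}) (E_dim : \dim E = p)
    (E_inv : forall x : 'cV[R]_n, x \in E -> A *m x \in E) :
  exists2 s : quotO R n p,
    orthonormal_bases p E = [set \val X | X in [set X : Mstar R n p | classO X = s]]
  & exists U : set 'M[R]_(n, p),
    [/\ open U, U `<=` fullrank R n p, orthonormal_bases p E `<=` U &
      forall X0 : Mstar R n p, U (\val X0) ->
        exists X : nat -> Mstar R n p,
          [/\ X 0%N = X0,
              forall k, newton_step A (X k) (X k.+1) &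
              converges_quadratically (@quot_chart R n p)
                (fun k => classO (X k)) s]].
Proof.
have [q nE] : exists q, n = (p + q)%N by exists (n - p)%N; rewrite subnKC// ltnW.
subst n.
have [V [C [VE CC VC]]] := exists_orthonormal_basis E_dim.
have [_ VV] := VE.
have AV := invariant_compression E_inv VE; set M := V^T *m A *m V in AV.
have M_posdef (x : 'cV[R]_p) : x != 0 -> 0 < (x^T *m M *m x) 0 0.
  move=> x0; rewrite /M !mulmxA -(mulmxA (_ *m A)) -trmx_mul; apply: A_posdef.
  apply: contraNneq x0 => Vx; apply/eqP.
  by rewrite -[x]mul1mx -VV -mulmxA Vx mulmx0.
have lambda_inj : injective lambda.
  move=> i j lij; apply: val_inj.
  by case: (ltngtP i j) => // /lambda_decr; rewrite lij ltxx.
have normal_inj (Z : 'M[R]_(p + q, p)) : V^T *m Z = 0 -> A *m Z = Z *m M -> Z = 0.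
  by move=> VZ AZ; apply: (invariant_normal_eq0 A_sym lambda_inj A_eigen VV CC VC AV).
have [eps [kappa [eps_gt0 kappa_ge0 eps_small contracts]]] :=
  newton_contracts VV CC VC A_sym AV M_posdef normal_inj.
have [Vs VsE] : exists Vs : Mstar R (p + q) p, \val Vs = V.
  by apply/Mstar_ex/fullrankE; rewrite VV unitmx1.
exists (classO Vs).
  apply/seteqP; split=> [X /(orthonormal_basesP _ VE)[Q QQ XE]|_ [X Xs <-]].
    have [Y YE] : exists Y : Mstar R (p + q) p, \val Y = X.
      by apply/Mstar_ex/fullrankE; rewrite XE gram_mulQ_unit// VV unitmx1.
    exists Y => //; apply/esym/classO_eqP; exists Q => //.
    by rewrite VsE YE.
  apply/(orthonormal_basesP _ VE); move: Xs => /esym/classO_eqP[Q QQ XE].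
  by exists Q => //; rewrite XE VsE.
exists (orbit_ball V C eps); split.
- exact: orbit_ball_open.
- exact: orbit_ball_fullrank.
- move=> X /(orthonormal_basesP _ VE)[Q QQ ->].
  by rewrite /orbit_ball/= orbit_dist_mulQ// orbit_dist_base.
move=> X0 X0U.
(* The iteration is extended to all full-rank matrices, by the identity. *)
have next_ex (X : Mstar R (p + q) p) : exists Y : Mstar R (p + q) p,
    orbit_ball V C eps (\val X) -> [/\ newton_step A X Y,
      orbit_dist V C (\val Y) <= kappa * orbit_dist V C (\val X) ^+ 2 &
      orbit_dist V C (\val Y) <= 2^-1 * orbit_dist V C (\val X)].
  have [XU|XU] := pselect (orbit_ball V C eps (\val X)); last by exists X.
  have [_ [Z uniZ [quad half]]] := contracts _ XU.
  have XZU : orbit_ball V C eps (\val X + Z).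
    rewrite /orbit_ball/= (le_lt_trans half)// (le_lt_trans _ XU)//.
    by rewrite ler_piMl ?normr_ge0// invf_le1// ler1n.
  have [Y YE] := Mstar_ex (orbit_ball_fullrank VV CC VC eps_small XZU).
  by exists Y => _; rewrite YE; split => //; exists Z.
have [next nextP] := choice next_ex.
pose X k := iter k next X0.
have XU k : orbit_ball V C eps (\val (X k)).
  elim: k => [//|k XkU]; have [_ _ half] := nextP _ XkU.
  rewrite /orbit_ball/= (le_lt_trans half)// (le_lt_trans _ XkU)//.
  by rewrite ler_piMl ?normr_ge0// invf_le1// ler1n.
have step k := nextP _ (XU k).
exists X; split=> // [k|]; first by have [] := step k.
split.
  apply: (orbit_dist_cvg VV CC VC eps_gt0 eps_small VsE).
  apply: geometric_decay => [|k]; first exact: normr_ge0.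
  by have [] := step k.
exists (chart_dom V C eps), (chart_fun V C); split.
- exact: quot_chart_invariant.
- apply/chart_dom_class => //; rewrite VsE /orbit_ball/=.
  by rewrite orbit_dist_base.
exists kappa, 0%N; split=> // k _; split; first exact/chart_dom_class.
rewrite !chart_fun_class VsE !coordinates_distE.
by have [] := step k.
Qed.
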